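(* For every $z\in\mathbb R$, $$\lim_{s\to\infty}B\Big(s,\,s+z\frac{\sigma}{\sqrt{2s}}\Big)=\Phi(z):=\frac1{\sqrt{2\pi}}\int_{-\infty}^z \exp\Big\{-\frac{y^2}{2}\Big\}\,dy .$$
   Context: Let $W$ be a standard one-dimensional Wiener process on a probability space $(\Omega,\mathcal F,\mathbb P)$ with $W(0)=0$, and let $\sigma>0$. For $s\ge 0$ and $x\in\mathbb R$, let $X_{s,t}(x)$, $t\ge s$, denote the unique local solution of the stochastic differential equation $$dX(t)=X(t)\big(X(t)-t\big)\,dt+\sigma\,dW(t),\quad t\ge s,\qquad X(s)=x.$$ The blow-up time is $\beta_s(x):=\lim_{n\to\infty}\inf\{t>s:\ |X_{s,t}(x)|\ge n\}\in(s,\infty]$, and $B(s,x):=\mathbb P(\beta_s(x)<\infty)$ is the blow-up probability of the solution started at $(s,x)$. *)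

(* Defs.v *)
From HB Require Import structures.
From mathcomp Require Import all_boot all_order all_algebra.
From mathcomp Require Import all_classical all_reals all_analysis.
From mathcomp Require Import measurable_realfun.
Import Order.TTheory GRing.Theory Num.Theory.
Import numFieldNormedType.Exports.

Set Implicit Arguments.
Unset Strict Implicit.
Unset Printing Implicit Defensive.

Local Open Scope classical_set_scope.
Local Open Scope ring_scope.

(* A process indexed by time is a function on all of R; only times >= 0 are
   constrained.  The second parameter of normal_prob is the standard
   deviation. *)
Record wiener_process (R : realType) (d : measure_display)
    (T : measurableType d) (P : probability T R) (W : R -> {RV P >-> R}) :
    Prop := WienerProcess {
  wiener_start : {ae P, forall w, W 0 w = 0} ;
  wiener_gaussian : forall u t : R, 0 <= u -> u < t ->
    forall A : set R, measurable A ->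
      pushforward P (fun w => W t w - W u w) A =
        normal_prob 0 (Num.sqrt (t - u)) A ;
  wiener_independent : forall (n : nat) (t : nat -> R) (A : nat -> set R),
    0 <= t 0%N -> (forall i, t i <= t i.+1) -> (forall i, measurable (A i)) ->
    P (\bigcap_(i < n) (fun w => W (t i.+1) w - W (t i) w) @^-1` A i) =
    (\prod_(i < n) P ((fun w => (W (t i.+1) w - W (t i) w)%R) @^-1` A i))%E ;
  wiener_continuous :
    {ae P, forall w, {within `[0, +oo[, continuous (fun t : R => W t w)}}
}.

(* Paths take values in [-oo, +oo], so that they can be continued past an
   explosion.  The infimum of the empty set is +oo. *)
Definition hitting_time (R : realType) (s : R) (f : R -> \bar R) (n : nat) :
    \bar R :=
  ereal_inf [set t%:E | t in [set t : R | s < t /\ (n%:R%:E <= `|f t|)%E]].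

Definition blowup_time (R : realType) (s : R) (f : R -> \bar R) : \bar R :=
  limn (hitting_time s f).

(* Local solution, up to its blow-up time, of
     dX = X (X - t) dt + sigma dW,  X(s) = x.
   As sigma is constant, the stochastic integral of sigma over [s, t] is
   sigma (W t - W s), so the integral equation is meaningful path by path.
   Continuity as a map into [-oo, +oo] forces |X| to tend to +oo at a finite
   blow-up time: the equation then holds on the maximal interval of existence.
   Since path properties are only required almost surely and P need not be
   complete, measurability of the blow-up time is part of the definition. *)
Record local_solution (R : realType) (d : measure_display)
    (T : measurableType d) (P : probability T R) (W : R -> {RV P >-> R})
    (sigma s x : R) (X : R -> T -> \bar R) : Prop := LocalSolution {
  solution_measurable : forall t, s <= t -> measurable_fun setT (X t) ;
  blowup_time_measurable :
    measurable_fun setT (fun w => blowup_time s (fun t => X t w)) ;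
  solution_start : {ae P, forall w, X s w = x%:E} ;
  solution_continuous :
    {ae P, forall w, {within `[s, +oo[, continuous (fun t : R => X t w)}} ;
  solution_equation : {ae P, forall w, forall t : R,
    s <= t -> (t%:E < blowup_time s (fun u => X u w))%E ->
    X t w = (x
      + (\int[lebesgue_measure]_(u in `[s, t])
            (fine (X u w) * (fine (X u w) - u)))
      + sigma * (W t w - W s w))%:E}
}.

Definition blowup_probability (R : realType) (d : measure_display)
    (T : measurableType d) (P : probability T R) (s : R)
    (X : R -> T -> \bar R) : \bar R :=
  P [set w | (blowup_time s (fun t => X t w) < +oo)%E].

Definition Phi (R : realType) (z : R) : R :=
  (Num.sqrt (2 * pi))^-1 *
  \int[lebesgue_measure]_(y in `]-oo, z]) expR (- (y ^+ 2 / 2)).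

(* Main.v *)
(* With w(t) = sigma (W_t - W_s), the noise enters additively, so the equation
   can be solved path by path.  Let D be the bounded solution of dD = t D dt + dw
   on [s, +oo[; then Z = X - t - D satisfies the ordinary differential equation
   Z' = (Z + D)^2 + t Z - 1.  As long as |D| <= 1, this equation explodes if
   Z(s) > 1/s and preserves Z <= 0, which rules out explosion.  Up to O(1/s),
   Z(s) = x - s + N, where N is a Riemann sum of
   int_s^oo exp((s^2 - u^2)/2) dw(u); N is Gaussian, centred, with variance
   equivalent to sigma^2/(2s), whence the limit Phi(z).  In the time scale
   r = (t^2 - s^2)/2 the kernel is exp(-r), and dyadic chaining of the increments
   of W shows that |D| <= 1 fails with probability O(1/s^2). *)
Require Import Defs.
From mathcomp Require Import all_boot all_order all_algebra.
From mathcomp Require Import all_classical all_reals all_analysis.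
From mathcomp Require Import measurable_realfun.
From mathcomp Require Import ring lra zify.
Import Order.TTheory GRing.Theory Num.Theory.
Import numFieldNormedType.Exports.

Local Open Scope classical_set_scope.
Local Open Scope ring_scope.
Set Implicit Arguments.
Unset Strict Implicit.
Unset Printing Implicit Defensive.

(** * Differential inequalities and chaining *)

Section calculus.
Variable R : realType.
Implicit Types (f g df : R -> R) (a b s t : R).

(** The dichotomy leaves a window of starting values of width O(1/s) undecided. This is harmless
    because the noise has a standard deviation of the larger order 1/sqrt(s): after standardisation
    the window shrinks like 1/sqrt(s). The obstacle is that D is determined by the whole future of
    the path. It enters only through a constant C with exp(s^2/2) C close to N, which is constructed
    path by path as a supremum and is never treated as a random variable. Outside a small measurable
    set of paths, exp(s^2/2) C lies within a deterministic distance of a finite weighted sum of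
    increments of W. Only events about that sum are measured, and its law is exactly Gaussian for
    every s, so the limit is taken in an explicit expression in Phi. The dyadic control of
    increments serves twice: at unit scale it gives |D| <= 1, and at the mesh scale it bounds the
    error of the Riemann sum. *)

Lemma is_derive_add f g a b t : is_derive t 1 f a -> is_derive t 1 g b ->
  is_derive t 1 (fun x => f x + g x) (a + b).
Proof. by move=> df dg; apply: is_deriveD. Qed.

Lemma is_derive_sub f g a b t : is_derive t 1 f a -> is_derive t 1 g b ->
  is_derive t 1 (fun x => f x - g x) (a - b).
Proof. by move=> df dg; apply: is_deriveB. Qed.

Lemma is_derive_mul f g a b t : is_derive t 1 f a -> is_derive t 1 g b ->
  is_derive t 1 (fun x => f x * g x) (a * g t + f t * b).
Proof.
move=> df dg; apply: is_derive_eq.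
by rewrite /GRing.scale /=; ring.
Qed.

Lemma is_derive_expR_comp f a t : is_derive t 1 f a ->
  is_derive t 1 (fun x => expR (f x)) (expR (f t) * a).
Proof. by move=> df; apply: is_derive_eq; rewrite mulrC. Qed.

Lemma is_derive_inv f a t : is_derive t 1 f a -> f t != 0 ->
  is_derive t 1 (fun x => (f x)^-1) (- a / f t ^+ 2).
Proof.
move=> df f0; apply: is_derive_eq.
by rewrite /GRing.scale /= -exprVn; ring.
Qed.

Lemma is_derive_sqr t : is_derive t 1 (fun x : R => x ^+ 2) (2 * t).
Proof.
have := is_derive_mul (is_derive_id t (1:R)) (is_derive_id t (1:R)).
by move=> h; apply: is_derive_eq; rewrite /GRing.scale /=; ring.
Qed.

Lemma is_derive_gauss (k : R) t :
  is_derive t 1 (fun x : R => expR (k * x ^+ 2)) (2 * k * t * expR (k * t ^+ 2)).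
Proof.
have h := is_derive_mul (is_derive_cst k t (1:R)) (is_derive_sqr t).
have h2 := is_derive_expR_comp h.
by apply: (is_derive_eq h2); rewrite /=; ring.
Qed.

Lemma is_derive_continuous f a t : is_derive t 1 f a -> {for t, continuous f}.
Proof. by case=> df _; apply: differentiable_continuous; apply/derivable1_diffP. Qed.

Lemma is_derive_within_continuous f df a b :
  (forall t, a <= t <= b -> is_derive t 1 f (df t)) ->
  {within `[a, b], continuous f}.
Proof.
move=> h; apply: derivable_within_continuous => t; rewrite in_itv /= => /h [].
by [].
Qed.

Lemma is_derive_le f df a b : a <= b ->
  (forall t, a <= t <= b -> is_derive t 1 f (df t)) ->
  (forall t, a < t < b -> 0 <= df t) -> f a <= f b.
Proof.
rewrite le_eqVlt => /predU1P[->//|ab] h df0.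
have [|c] := @MVT _ f df a b ab _ (is_derive_within_continuous h).
  by move=> x; rewrite in_itv /= => /andP[ax xb]; apply: h; rewrite !ltW.
rewrite in_itv /= => cab e.
by rewrite -subr_ge0 e mulr_ge0 ?subr_ge0 ?df0// ltW.
Qed.

(** Gronwall's argument, started at the last time [c] where f <= 0. Beyond [c] the function is
    positive, which is where the bound on [df] is available, so f(t) exp(-K t) cannot increase from
    its nonpositive value at [c]. *)
Lemma is_derive_nonpos f df a b (K : R) : a <= b ->
  (forall t, a <= t <= b -> is_derive t 1 f (df t)) ->
  f a <= 0 -> (forall t, a <= t <= b -> 0 < f t -> df t <= K * f t) ->
  f b <= 0.
Proof.
move=> ab h fa hK; rewrite leNgt; apply/negP => fb.
have cf := is_derive_within_continuous h.
pose A := [set t | a <= t <= b /\ f t <= 0].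
have Aa : A a by split => //; rewrite lexx.
have Aub : ubound A b by move=> t [] /andP[].
have hs : has_sup A by split; [exists a|exists b].
set c := sup A.
have ac : a <= c by apply: ub_le_sup => //; case: hs.
have cb : c <= b by apply: ge_sup => //; exists a.
have pos t : c < t -> t <= b -> 0 < f t.
  move=> ct tb; rewrite ltNge; apply/negP => ft.
  have : t <= c.
    apply: ub_le_sup; first by case: hs.
    by split => //; rewrite tb (le_trans ac (ltW ct)).
  by rewrite leNgt ct.
have fc : f c <= 0.
  rewrite leNgt; apply/negP => fc0.
  have cfc : {for c, continuous f}.
    by apply: (is_derive_continuous (h c _)); rewrite ac cb.
  have /nbhs_ballP[e /= e0 he] : nbhs c [set t | 0 < f t].
    exact: (cvgr_gt _ cfc _ fc0).
  have [t [/andP[at_ tb] ft] tc] := sup_adherent e0 hs.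
  have tc' : t <= c by apply: ub_le_sup; [case: hs|split; rewrite ?at_].
  have /he : ball c e t.
    rewrite /ball /= /ball_ ger0_norm ?subr_ge0//.
    by rewrite ltrBlDl -ltrBlDr.
  by rewrite /= ltNge ft.
pose g t := f t * expR (- K * t).
have dg t : c <= t <= b -> is_derive t 1 (fun x => - g x)
    (- (df t * expR (- K * t) + f t * (expR (- K * t) * - K))).
  move=> /andP[ct tb].
  have d1 : is_derive t 1 (fun x : R => - K * x) (- K).
    have := is_derive_mul (is_derive_cst (- K) t (1:R)) (is_derive_id t (1:R)).
    by move=> d; apply: (is_derive_eq d); rewrite /=; ring.
  have d2 := is_derive_mul (h t _) (is_derive_expR_comp d1).
  by apply: is_deriveN; apply: d2; rewrite (le_trans ac ct) tb.
have : - g c <= - g b.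
  apply: (is_derive_le cb dg) => t /andP[ct tb].
  have ft := pos t ct (ltW tb).
  have := hK t _ ft; rewrite (le_trans ac (ltW ct)) (ltW tb) => /(_ isT) hdf.
  have -> : - (df t * expR (- K * t) + f t * (expR (- K * t) * - K)) =
     (K * f t - df t) * expR (- K * t) by ring.
  by rewrite mulr_ge0 ?expR_ge0// subr_ge0.
have : g c <= 0 by rewrite /g mulr_le0_ge0 ?expR_ge0.
have : 0 < g b by rewrite /g mulr_gt0 ?expR_gt0.
lra.
Qed.
Lemma ode_nonpos_preserved (Z D : R -> R) s b : 0 <= s -> s <= b ->
  (forall t, s <= t <= b ->
    is_derive t 1 Z ((Z t + D t) ^+ 2 + t * Z t - 1)) ->
  (forall t, s <= t <= b -> `|D t| <= 1) ->
  Z s <= 0 -> Z b <= 0.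
Proof.
move=> s0 sb dZ D1 Zs.
have [c _ hc] := EVT_max sb (is_derive_within_continuous dZ).
(* Where Z > 0, the term D^2 - 1 <= 0 drops out and Z^2 + 2 Z D + t Z <= (max Z + 2 + b) Z. *)
apply: (is_derive_nonpos (K := Z c + 2 + b) sb dZ Zs) => t ht Zt.
have Ztc : Z t <= Z c by apply: hc; rewrite in_itv.
have := D1 t ht; rewrite ler_norml => /andP[D1' D2'].
have D3 : D t ^+ 2 <= 1 by rewrite expr2; nra.
case/andP : ht => st tb.
nra.
Qed.

(** Two regimes. Dropping the square, Z' >= t Z - 1 >= t (Z - 1/s), so Z - 1/s grows at least like
    exp((t^2 - s^2)/2). Once Z >= 2, |D| <= 1 gives (Z + D)^2 >= Z^2/4, so 1/Z decreases at rate at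
    least 1/4 and would become negative in finite time. *)
Lemma ode_explodes (Z D : R -> R) s : 0 < s ->
  (forall t, s <= t -> is_derive t 1 Z ((Z t + D t) ^+ 2 + t * Z t - 1)) ->
  (forall t, s <= t -> `|D t| <= 1) ->
  s^-1 < Z s -> False.
Proof.
move=> s0 dZ D1 Zs.
pose k : R := - 2^-1.
have si : s * s^-1 = 1 by rewrite divff// gt_eqF.
set p := s^-1 in Zs si.
have p0 : 0 < p by rewrite invr_gt0.
have grow t : s <= t -> p + (Z s - p) * (1 + (t ^+ 2 - s ^+ 2) / 2) <= Z t.
  move=> st.
  have dF x : s <= x <= t -> is_derive x 1
      (fun x => expR (k * x ^+ 2) * (Z x - p))
      (expR (k * x ^+ 2) * (((Z x + D x) ^+ 2 + x * Z x - 1) - x * (Z x - p))).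
    move=> /andP[sx _].
    have h := is_derive_mul (is_derive_gauss k x)
      (is_derive_sub (dZ x sx) (is_derive_cst p x (1:R))).
    by apply: (is_derive_eq h) => /=; rewrite /k; field.
  have le1 : expR (k * s ^+ 2) * (Z s - p) <= expR (k * t ^+ 2) * (Z t - p).
    apply: (is_derive_le st dF) => x /andP[sx xt].
    rewrite mulr_ge0 ?expR_ge0//.
    have := sqr_ge0 (Z x + D x); nra.
  have : expR (- k * (t ^+ 2 - s ^+ 2)) * (Z s - p) <= Z t - p.
    have -> : - k * (t ^+ 2 - s ^+ 2) = - (k * t ^+ 2) + k * s ^+ 2 by ring.
    by rewrite expRD -mulrA expRN ler_pdivrMl ?expR_gt0.
  have := expR_ge1Dx (- k * (t ^+ 2 - s ^+ 2)).
  have : 0 < Z s - p by rewrite subr_gt0.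
  rewrite /k; nra.
(* Since (t^2 - s^2)/2 >= s (t - s), the lower bound [grow] exceeds 4, hence 2, from this time
   on. *)
pose t0 := s + 4 / (s * (Z s - p)).
have Zp : 0 < Z s - p by rewrite subr_gt0.
have t0s : s <= t0 by rewrite /t0 lerDl divr_ge0 ?mulr_ge0 ?ltW.
have big t : t0 <= t -> 2 <= Z t.
  move=> t0t; apply: le_trans (grow t (le_trans t0s t0t)).
  have : 4 <= s * (Z s - p) * (t - s).
    rewrite -ler_pdivrMl ?mulr_gt0// mulrC.
    by rewrite lerBrDl.
  have : 0 <= t - s by rewrite subr_ge0 (le_trans t0s).
  nra.
have dV t : t0 <= t -> is_derive t 1 (fun x => - ((Z x)^-1 + x / 4))
    (- (- ((Z t + D t) ^+ 2 + t * Z t - 1) / Z t ^+ 2 + 4^-1)).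
  move=> t0t; apply: is_deriveN.
  have Z0 : Z t != 0 by rewrite gt_eqF// (lt_le_trans _ (big _ t0t)).
  have h1 := is_derive_inv (dZ t (le_trans t0s t0t)) Z0.
  have h2 := is_derive_mul (is_derive_id t (1:R)) (is_derive_cst (4^-1 : R) t (1:R)).
  by apply: (is_derive_eq (is_derive_add h1 h2)); rewrite /=; ring.
have dec t : t0 <= t -> - ((Z t0)^-1 + t0 / 4) <= - ((Z t)^-1 + t / 4).
  move=> t0t.
  have dVt x (hx : t0 <= x <= t) := dV x (proj1 (andP hx)).
  apply: (is_derive_le t0t dVt) => x /andP[t0x _].
  have Zx := big _ (ltW t0x).
  have := D1 x (le_trans t0s (ltW t0x)); rewrite ler_norml => /andP[D1' D2'].
  have Zx2 : 0 < Z x ^+ 2 by rewrite exprn_gt0// (lt_le_trans _ Zx).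
  rewrite mulNr opprD opprK subr_ge0.
  rewrite ler_pdivlMr// mulrC ler_pdivrMr//.
  have sx : s <= x := le_trans t0s (ltW t0x).
  have : p <= Z x by rewrite (le_trans _ (grow x sx))// lerDl mulr_ge0 ?ltW//; nra.
  nra.
have Z0 := big _ (lexx t0).
have iZ0 : (Z t0)^-1 <= 2^-1 by rewrite lef_pV2 ?posrE// (lt_le_trans _ Z0).
(* Over a time 4, 1/Z loses at least 1, although it starts from at most 1/2. *)
have h1 : t0 <= t0 + 4 by rewrite lerDl.
have := dec _ h1.
have : 0 < (Z (t0 + 4))^-1 by rewrite invr_gt0 (lt_le_trans _ (big _ h1)).
lra.
Qed.

(** Comparison with a barrier [psi] for which J + exp(-r^2/2) psi is nondecreasing. Its derivative
    is r exp(-r^2/2) (w - psi - 1/4), where 1/4 comes from the slope of [psi]. The allowed variation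
    of w takes another 1/4, whence the offset 1/2 in [psi]; the slope 1/8 in r^2 matches that of the
    allowed variation. *)
Lemma stationary_le (w J : R -> R) t u : 0 <= t -> t <= u ->
  (forall r, t <= r <= u ->
    is_derive r 1 J (r * expR (- 2^-1 * r ^+ 2) * w r)) ->
  (forall r, t <= r <= u -> `|w r - w t| <= 4^-1 + (r ^+ 2 - t ^+ 2) / 8) ->
  J t + expR (- 2^-1 * t ^+ 2) * (w t - 1) <=
  J u + expR (- 2^-1 * u ^+ 2) * (w u + 1).
Proof.
move=> t0 tu dJ hw.
pose k : R := - 2^-1.
pose psi r := w t - 2^-1 - (r ^+ 2 - t ^+ 2) / 8.
have dF r : t <= r <= u -> is_derive r 1
    (fun x => J x + expR (k * x ^+ 2) * psi x)
    (r * expR (k * r ^+ 2) * (w r - psi r - 4^-1)).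
  move=> hr.
  have d1 := is_derive_mul (is_derive_sub (is_derive_sqr r)
    (is_derive_cst (t ^+ 2) r (1 : R))) (is_derive_cst (8^-1 : R) r (1 : R)).
  have d2 := is_derive_mul (is_derive_gauss k r)
    (is_derive_sub (is_derive_cst (w t - 2^-1) r (1 : R)) d1).
  by apply: (is_derive_eq (is_derive_add (dJ r hr) d2)) => /=; rewrite /psi /k; field.
have le1 : J t + expR (k * t ^+ 2) * psi t <= J u + expR (k * u ^+ 2) * psi u.
  apply: (is_derive_le tu dF) => r /andP[tr ru].
  rewrite mulr_ge0// ?mulr_ge0 ?expR_ge0 ?(le_trans t0 (ltW tr))//.
  have := hw r; rewrite (ltW tr) (ltW ru) => /(_ isT); rewrite ler_norml /psi.
  by move=> /andP[]; lra.
have := hw u; rewrite tu lexx => /(_ isT); rewrite ler_norml => /andP[h1 h2].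
have e1 : expR (k * t ^+ 2) * (w t - 1) <= expR (k * t ^+ 2) * psi t.
  by rewrite ler_wpM2l ?expR_ge0// /psi; lra.
have e2 : expR (k * u ^+ 2) * psi u <= expR (k * u ^+ 2) * (w u + 1).
  by rewrite ler_wpM2l ?expR_ge0// /psi; lra.
rewrite -/k; lra.
Qed.

(* D(t) = w(t) - exp(t^2/2) (C - J(t)) solves dD = t D dt + dw for every
   constant C, and |D(t)| <= 1 confines C to an interval depending on t; by
   [stationary_le] any two of these intervals meet. *)
Lemma stationary_exists (w J : R -> R) s : 0 <= s ->
  (forall r, s <= r -> is_derive r 1 J (r * expR (- 2^-1 * r ^+ 2) * w r)) ->
  (forall t u, s <= t -> t <= u ->
    `|w u - w t| <= 4^-1 + (u ^+ 2 - t ^+ 2) / 8) ->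
  exists C, forall t, s <= t ->
    `|w t - expR (2^-1 * t ^+ 2) * (C - J t)| <= 1.
Proof.
move=> s0 dJ hw.
pose a t := J t + expR (- 2^-1 * t ^+ 2) * (w t - 1).
pose b t := J t + expR (- 2^-1 * t ^+ 2) * (w t + 1).
have ab t u : s <= t -> s <= u -> a t <= b u.
  move=> st su; have [tu|/ltW ut] := leP t u.
    apply: stationary_le => // [|r /andP[tr _]|r /andP[tr _]].
    - exact: le_trans st.
    - exact/dJ/(le_trans st).
    - exact: hw.
  (* For u <= t, changing the signs of w and J turns lower ends of intervals into upper ends. *)
  have := @stationary_le (fun x => - w x) (fun x => - J x) u t.
  rewrite /a /b => H; suff : - J u + expR (- 2^-1 * u ^+ 2) * (- w u - 1) <=
    - J t + expR (- 2^-1 * t ^+ 2) * (- w t + 1) by lra.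
  apply: H => // [|r /andP[tr _]|r /andP[tr _]].
  - exact: le_trans su.
  - have d := is_deriveN (dJ r (le_trans su tr)).
    by apply: (is_derive_eq d); ring.
  - by rewrite -opprD normrN hw.
pose A := [set a t | t in [set t | s <= t]].
have hA : has_sup A.
  split; first by exists (a s), s => /=.
  by exists (b s) => _ [t st <-]; exact: ab.
exists (sup A) => t st.
have h1 : a t <= sup A by apply: ub_le_sup; [case: hA|exists t].
have h2 : sup A <= b t.
  by apply: ge_sup; [case: hA|move=> _ [u su <-]; exact: ab].
have E : expR (2^-1 * t ^+ 2) * expR (- 2^-1 * t ^+ 2) = 1.
  by rewrite -expRD mulNr subrr expR0.
have h1' : expR (2^-1 * t ^+ 2) * (a t - J t) <= expR (2^-1 * t ^+ 2) * (sup A - J t).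
  by rewrite ler_wpM2l ?expR_ge0// lerD2r.
have h2' : expR (2^-1 * t ^+ 2) * (sup A - J t) <= expR (2^-1 * t ^+ 2) * (b t - J t).
  by rewrite ler_wpM2l ?expR_ge0// lerD2r.
have e1 : expR (2^-1 * t ^+ 2) * (a t - J t) = w t - 1.
  by rewrite /a addrAC subrr add0r mulrA E mul1r.
have e2 : expR (2^-1 * t ^+ 2) * (b t - J t) = w t + 1.
  by rewrite /b addrAC subrr add0r mulrA E mul1r.
rewrite ler_norml; apply/andP; lra.
Qed.

Lemma invr_exp2_small (e : R) : 0 < e -> exists n : nat, (2 ^+ n)^-1 < e.
Proof.
move=> e0; exists (Num.truncn e^-1).+1.
rewrite invf_plt ?posrE ?exprn_gt0//.
apply: (lt_le_trans (truncnS_gt _)).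
by rewrite -natrX ler_nat ltnW// ltn_expl.
Qed.

(** Let [d n r] be the dyadic floor of r at level n. Passing to level n+1 moves it by at most one
    cell of that level, so the distance from g(r) to g([d m r]) is at most c times the sum of q^n
    over n > m, which is 7 c q^m for q = 7/8. The floors of r and r' at level m are equal or
    adjacent, which costs one more c q^m: 7 + 7 + 1 = 15. *)
Lemma chaining (g : R -> R) (c : R) : {in [set r | 0 <= r], continuous g} ->
  (forall n j : nat, `|g (j.+1%:R / 2 ^+ n) - g (j%:R / 2 ^+ n)| <= c * (7 / 8) ^+ n) ->
  forall (m : nat) r r', 0 <= r -> r <= r' -> r' <= r + (2 ^+ m)^-1 ->
  `|g r' - g r| <= 15 * c * (7 / 8) ^+ m.
Proof.
move=> cg hg.
set q : R := 7 / 8.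
have q0 : 0 <= q by rewrite /q; lra.
have c0 : 0 <= c by have := hg 0%N 0%N; rewrite expr0 mulr1; apply: le_trans.
pose d (n : nat) (r : R) : R := (Num.truncn (r * 2 ^+ n))%:R / 2 ^+ n.
have p2 n : 0 < 2 ^+ n :> R by rewrite exprn_gt0.
have d_le n r : 0 <= r -> d n r <= r.
  by move=> r0; rewrite ler_pdivrMr// truncn_le// mulr_ge0// ltW.
have d_gt n r : r < d n r + (2 ^+ n)^-1.
  rewrite /d -[X in _ + X]mul1r -mulrDl ltr_pdivlMr// natr1.
  exact: truncnS_gt.
have step n r : 0 <= r -> `|g (d n.+1 r) - g (d n r)| <= c * q ^+ n.+1.
  move=> r0; set j := Num.truncn (r * 2 ^+ n).
  have rn0 k : 0 <= r * 2 ^+ k by rewrite mulr_ge0// ltW.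
  have jle : j%:R <= r * 2 ^+ n by rewrite truncn_le.
  have jgt : r * 2 ^+ n < j.+1%:R by rewrite truncnS_gt.
  set i := Num.truncn (r * 2 ^+ n.+1).
  have ile : i%:R <= r * 2 ^+ n.+1 by rewrite truncn_le.
  have igt : r * 2 ^+ n.+1 < i.+1%:R by rewrite truncnS_gt.
  have dj : d n r = (j.*2)%:R / 2 ^+ n.+1.
    rewrite /d -/j exprS -muln2 natrM invfM.
    by field; rewrite gt_eqF.
  have li : (j.*2 <= i)%N.
    rewrite -ltnS -(ltr_nat R) (le_lt_trans _ igt)// -muln2 natrM exprS.
    by rewrite mulrCA mulrC ler_pM2l.
  have ui : (i <= j.*2.+1)%N.
    rewrite -ltnS -(ltr_nat R) (le_lt_trans ile)//.
    have -> : j.*2.+2 = (j.+1 * 2)%N by rewrite muln2 doubleS.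
    by rewrite natrM exprS mulrCA mulrC ltr_pM2r.
  rewrite dj /d -/i.
  have [->|ij] := eqVneq i j.*2.
    by rewrite subrr normr0 mulr_ge0// exprn_ge0.
  have -> : i = j.*2.+1 by lia.
  exact: hg.
(* The geometric sum in telescoped form: q^(n+1) = 7 (q^n - q^(n+1)). *)
have steps n k r : 0 <= r ->
    `|g (d (n + k)%N r) - g (d n r)| <= 7 * c * (q ^+ n - q ^+ (n + k)).
  move=> r0; elim: k => [|k IH]; first by rewrite addn0 !subrr normr0 mulr0.
  rewrite addnS; have := step (n + k)%N r r0.
  have := ler_distD (g (d (n + k)%N r)) (g (d (n + k).+1 r)) (g (d n r)).
  have : c * q ^+ (n + k).+1 = 7 * c * (q ^+ (n + k) - q ^+ (n + k).+1).
    by rewrite exprS /q; field.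
  lra.
have lim n r : 0 <= r -> `|g r - g (d n r)| <= 7 * c * q ^+ n.
  move=> r0; apply/ler_addgt0Pr => e e0.
  have cr : {for r, continuous g} by apply: cg; rewrite inE.
  have /cvgrPdist_lt /(_ _ e0) /nbhs_ballP[eta /= eta0 he] := cr.
  have [m hm] := invr_exp2_small eta0.
  have /he : ball r eta (d (n + m)%N r).
    rewrite /ball /= ger0_norm ?subr_ge0 ?d_le//.
    rewrite (lt_trans _ hm)// ltrBlDl.
    apply: (lt_le_trans (d_gt (n + m)%N r)); rewrite lerD2l lef_pV2 ?posrE//.
    by rewrite ler_weXn2l ?leq_addl// ler1n.
  have := steps n m r r0.
  have := ler_distD (g (d (n + m)%N r)) (g r) (g (d n r)).
  have : 0 <= 7 * c * q ^+ (n + m) by rewrite !mulr_ge0 ?exprn_ge0.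
  rewrite /=; lra.
move=> m r r' r0 rr' hr'.
have r'0 : 0 <= r' := le_trans r0 rr'.
have h1 := lim m r r0.
have h2 := lim m r' r'0.
have h3 : `|g (d m r') - g (d m r)| <= c * q ^+ m.
  rewrite /d; set i := Num.truncn _; set j := Num.truncn _.
  have ji : (j <= i)%N by rewrite le_truncn// ler_wpM2r// ltW.
  have ij : (i <= j.+1)%N.
    rewrite -ltnS -(ltr_nat R).
    have h : i%:R <= r' * 2 ^+ m by rewrite truncn_le// mulr_ge0// ltW.
    apply: (le_lt_trans h).
    apply: (@le_lt_trans _ _ (r * 2 ^+ m + 1)).
      rewrite -[X in _ + X](@mulVf _ (2 ^+ m)) ?gt_eqF// -mulrDl.
      by rewrite ler_wpM2r// ltW.
    by rewrite -[X in _ < X]natr1 ltrD2r truncnS_gt.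
  have [->|ne] := eqVneq i j.
    by rewrite subrr normr0 mulr_ge0// exprn_ge0.
  have -> : i = j.+1 by lia.
  exact: hg.
have := ler_distD (g (d m r')) (g r') (g r).
have := ler_distD (g (d m r)) (g (d m r')) (g r).
rewrite (distrC (g (d m r)) (g r)).
lra.
Qed.

End calculus.

(** * The pathwise dichotomy *)

Section paths.
Variable R : realType.
Local Notation mu := (@lebesgue_measure R).

Lemma antiderivative (f : R -> R) (s : R) : continuous f ->
  exists F : R -> R, [/\ F s = 0,
    forall t, s <= t -> is_derive t 1 F (f t) &
    forall t, s <= t -> F t = \int[mu]_(u in `[s, t]) f u].
Proof.
move=> cf.
have intf (a b : R) : mu.-integrable `[a, b] (EFin \o f).
  apply: continuous_compact_integrable; first exact: segment_compact.
  exact: continuous_subspaceT.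
(* Integrating from s - 1 makes s an interior point, so that the derivative at s is two-sided. *)
pose G t := \int[mu]_(u in `[s - 1, t]) f u.
have GE t : s <= t -> G t - G s = \int[mu]_(u in `[s, t]) f u.
  move=> st; rewrite /G Rintegral_itvB ?bnd_simp//; last by lra.
  rewrite -Rintegral_itv_obnd_cbnd//.
  by apply: integrableS (intf s t) => //; exact: subset_itv_oc_cc.
exists (fun t => G t - G s); split => [|t st|t st]; rewrite ?subrr//; last exact: GE.
have [|||dG G'] := @continuous_FTC1_closed _ f (s - 1) t (t + 1) _ (intf _ _).
- by lra.
- by lra.
- exact: cf.
have d : is_derive t 1 G (f t) by apply: DeriveDef; [exact: dG|rewrite -derive1E; exact: G'].
by have := is_derive_sub d (is_derive_cst (G s) t (1 : R)); rewrite subr0.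
Qed.

(** By parts, J + exp(-r^2/2) w is the pathwise meaning of the integral of exp(-r^2/2) dw from
    [u 0]. On one cell, J + exp(-r^2/2) c has derivative r exp(-r^2/2) (w - c), hence is monotone
    for c equal to the right-end value of w minus or plus e. The cell errors, e times the drop of
    the weight, telescope. *)
Lemma riemann_sum_error (w J : R -> R) (u : nat -> R) (e : R) (n : nat) :
  0 <= u 0%N -> (forall i, u i <= u i.+1) -> w (u 0%N) = 0 -> J (u 0%N) = 0 ->
  (forall r, u 0%N <= r -> is_derive r 1 J (r * expR (- 2^-1 * r ^+ 2) * w r)) ->
  (forall i r, (i < n)%N -> u i <= r <= u i.+1 -> `|w (u i.+1) - w r| <= e) ->
  `|J (u n) + expR (- 2^-1 * u n ^+ 2) * w (u n) -
    \sum_(i < n) expR (- 2^-1 * u i ^+ 2) * (w (u i.+1) - w (u i))|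
  <= e * (expR (- 2^-1 * u 0%N ^+ 2) - expR (- 2^-1 * u n ^+ 2)).
Proof.
move=> u0 undec w0 J0 dJ; elim: n => [|n IH] hw.
  by rewrite big_ord0 w0 J0 mulr0 !subr0 addr0 normr0 subrr mulr0.
have := IH (fun i r lin => hw i r (ltnW lin)) => {}IH.
have u0n k : u 0%N <= u k by elim: k => // k; move/le_trans; apply.
pose k : R := - 2^-1.
have dF c r : u n <= r <= u n.+1 -> is_derive r 1
    (fun x => J x + expR (k * x ^+ 2) * c)
    (r * expR (k * r ^+ 2) * (w r - c)).
  move=> /andP[nr _].
  have d := is_derive_mul (is_derive_gauss k r) (is_derive_cst c r (1 : R)).
  have dJr := dJ r (le_trans (u0n n) nr).
  by apply: (is_derive_eq (is_derive_add dJr d)); rewrite /= /k; field.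
have hwn r : u n <= r <= u n.+1 -> `|w (u n.+1) - w r| <= e by apply: hw.
have pos r : u n < r -> 0 <= r * expR (k * r ^+ 2).
  by move=> nr; rewrite mulr_ge0 ?expR_ge0// (le_trans u0)// (le_trans (u0n n))// ltW.
have lo : J (u n) + expR (k * u n ^+ 2) * (w (u n.+1) - e) <=
    J (u n.+1) + expR (k * u n.+1 ^+ 2) * (w (u n.+1) - e).
  apply: (is_derive_le (undec n) (dF _)) => r /andP[nr rn].
  rewrite mulr_ge0 ?pos//.
  by have := hwn r; rewrite (ltW nr) (ltW rn) ler_norml => /(_ isT)/andP[]; lra.
have hi : J (u n.+1) + expR (k * u n.+1 ^+ 2) * (w (u n.+1) + e) <=
    J (u n) + expR (k * u n ^+ 2) * (w (u n.+1) + e).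
  rewrite -lerN2.
  have dN r (hr : u n <= r <= u n.+1) := is_deriveN (dF (w (u n.+1) + e) r hr).
  apply: (is_derive_le (undec n) dN) => r /andP[nr rn].
  rewrite -mulrN mulr_ge0 ?pos//.
  by have := hwn r; rewrite (ltW nr) (ltW rn) ler_norml => /(_ isT)/andP[]; lra.
rewrite big_ord_recr /=.
rewrite !ler_norml -!/k in IH *.
set S := \sum_(i < n) _ in IH *.
move: IH lo hi => /andP[]; rewrite !(mulrDr (expR _)) !(mulrBr e) !mulrN => *.
by apply/andP; split; lra.
Qed.

Lemma within_continuous_comp (U : topologicalType) (A : set R) (f : R -> U)
    (h : R -> R) :
  {within A, continuous f} -> continuous h -> (forall x, A (h x)) ->
  continuous (f \o h).
Proof.
move=> /subspace_continuousP cf ch hA x.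
apply: cvg_comp; last exact: (cf _ (hA x)).
move=> B wB; have : nbhs x (h @^-1` [set t | A t -> B t]) := ch x _ wB.
by apply: filterS => y; apply; exact: hA.
Qed.

Lemma within_itvcy_near (U : topologicalType) (s b : R) (f : R -> U) (B : set U) :
  {within `[s, +oo[, continuous f} -> s <= b -> nbhs (f b) B ->
  exists2 e : R, 0 < e & forall u, s <= u -> `|u - b| < e -> B (f u).
Proof.
move=> /subspace_continuousP cf sb nB.
have := cf b; rewrite /= in_itv /= sb => /(_ isT B nB) [e /= e0 he].
exists e => // u su ub; apply: (he u) => /=; rewrite ?in_itv/= ?su//.
by rewrite /ball /= distrC.
Qed.

(** * Blow-up time of a path with values in the extended reals *)

Section blowup.
Variables (s : R) (f : R -> \bar R).

Lemma hitting_time_ge n : (s%:E <= hitting_time s f n)%E.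
Proof. by apply: le_ereal_inf_tmp => _ [t [st _] <-]; rewrite lee_fin ltW. Qed.

Lemma hitting_time_nondecreasing : nondecreasing_seq (hitting_time s f).
Proof.
move=> n m nm; apply: ereal_inf_le_tmp => _ [t [st ft] <-]; exists t => //.
by split => //; apply: le_trans ft; rewrite lee_fin ler_nat.
Qed.

Lemma blowup_timeE : blowup_time s f = ereal_sup (range (hitting_time s f)).
Proof.
apply/cvg_lim => //; exact/ereal_nondecreasing_cvgn/hitting_time_nondecreasing.
Qed.

Lemma hitting_time_le_blowup n : (hitting_time s f n <= blowup_time s f)%E.
Proof. by rewrite blowup_timeE; apply: ereal_sup_ubound; exists n. Qed.

Lemma blowup_time_ge : (s%:E <= blowup_time s f)%E.
Proof. exact: le_trans (hitting_time_ge 0%N) (hitting_time_le_blowup 0%N). Qed.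

Lemma le_blowup_bounded (b M : R) :
  (forall u, s < u -> u < b -> (`|f u| <= M%:E)%E) -> (b%:E <= blowup_time s f)%E.
Proof.
move=> hM; pose n := (Num.truncn M).+1.
apply: le_trans (hitting_time_le_blowup n).
apply: le_ereal_inf_tmp => _ [t [st ft] <-]; rewrite lee_fin leNgt.
apply/negP => tb; have := le_trans ft (hM t st tb).
by rewrite lee_fin leNgt truncnS_gt.
Qed.

(** Continuity carries the bound M to b itself, and the bound M + 1 slightly beyond b. Applied at
    the blow-up time, this shows that a path cannot stay bounded up to a finite blow-up time. The
    alternative u = s covers b = s, where no u satisfies s <= u < b. *)
Lemma lt_blowup_extend (b M : R) : {within `[s, +oo[, continuous f} -> s <= b ->
  (forall u, s <= u -> u < b \/ u = s -> (`|f u| <= M%:E)%E) ->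
  (b%:E < blowup_time s f)%E.
Proof.
move=> cf sb hM.
have fb : (`|f b| <= M%:E)%E.
  rewrite leNgt; apply/negP => Mf.
  have nB : nbhs (f b) [set y | (M%:E < `|y|)%E].
    apply: (@abse_continuous R (f b) [set y | (M%:E < y)%E]).
    by apply: open_nbhs_nbhs; split; first exact: open_ereal_gt_ereal.
  have [e e0 he] := within_itvcy_near cf sb nB.
  move: sb; rewrite le_eqVlt => /predU1P[bs|sb].
    by move: Mf; rewrite ltNge hM//; [rewrite bs|right].
  pose u := Num.max s (b - e / 2).
  have ub : u < b by rewrite /u gt_max sb /=; lra.
  have su : s <= u by rewrite le_max lexx.
  have bu : b - e / 2 <= u by rewrite /u le_max lexx orbT.
  have : (M%:E < `|f u|)%E.
    by apply: he => //; rewrite ltr_norml; apply/andP; split; lra.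
  by rewrite ltNge hM//; left.
have nB : nbhs (f b) [set y | (`|y| < (M + 1)%:E)%E].
  apply: (@abse_continuous R (f b) [set y | (y < (M + 1)%:E)%E]).
  apply: open_nbhs_nbhs; split; first exact: open_ereal_lt_ereal.
  by rewrite /= (le_lt_trans fb)// lte_fin; lra.
have [e e0 he] := within_itvcy_near cf sb nB.
apply: (@lt_le_trans _ _ (b + e)%:E); first by rewrite lte_fin; lra.
apply: (@le_blowup_bounded _ (M + 1)) => u su ube.
have [ub|bu] := ltP u b.
  by rewrite (le_trans (hM u (ltW su) _))//; [left|rewrite lee_fin; lra].
apply: ltW; apply: he; first exact: ltW.
by rewrite ltr_norml; apply/andP; split; lra.
Qed.

End blowup.
(** The solution is as rough as w, but U, the solution minus the noise, is differentiable. The map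
    [h] clamps time to instants before blow-up, so that the path composed with [h] is finite and
    continuous on the whole line and the fundamental theorem of calculus applies; nothing changes
    where h u = u. *)
Lemma solution_smooth_part (s x : R) (f : R -> \bar R) (w h : R -> R) :
  {within `[s, +oo[, continuous f} -> continuous h ->
  (forall u, s <= h u) -> (forall u, ((h u)%:E < blowup_time s f)%E) ->
  (forall t, s <= t -> (t%:E < blowup_time s f)%E ->
    f t = (x + (\int[mu]_(u in `[s, t]) (fine (f u) * (fine (f u) - u))) + w t)%:E) ->
  exists U : R -> R, U s = x /\
    forall t, s <= t -> (forall u, s <= u <= t -> h u = u) ->
      f t = (U t + w t)%:E /\
      is_derive t 1 U ((U t + w t) * (U t + w t - t)).
Proof.
move=> cf ch sh hb eqf.
pose Y u := fine (f (h u)).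
have YE u : f (h u) = (Y u)%:E by rewrite /Y eqf.
have cY : continuous Y.
  move=> u; apply: fine_cvg; rewrite -YE.
  by apply: (within_continuous_comp cf ch) => v; rewrite /= in_itv /= sh.
have cg : continuous (fun u => Y u * (Y u - u)).
  by move=> u; apply: cvgM; [exact: cY|apply: cvgB; [exact: cY|exact: cvg_id]].
have [F [Fs dF FE]] := antiderivative s cg.
exists (fun t => x + F t); split; first by rewrite Fs addr0.
move=> t st hid.
have ht : h t = t by apply: hid; rewrite st lexx.
have ft : f t = (x + F t + w t)%:E.
  rewrite eqf//; last by rewrite -ht hb.
  congr (_ + _ + _)%:E; rewrite FE//; apply: eq_Rintegral => u.
  by rewrite inE /= in_itv /= => hu; rewrite /Y hid.
split=> //.
have -> : x + F t + w t = Y t by apply: EFin_inj; rewrite -ft -YE ht.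
have := is_derive_add (is_derive_cst x t (1 : R)) (dF t st).
by rewrite add0r.
Qed.

(** With D = w - I and X = U + w, the function Z = X - t - D equals U - t + I: the nondifferentiable
    w cancels. Since I' = t I - t w = -t D, the equation follows from X (X - t) = (Z + D)^2 + t (Z +
    D). *)
Lemma deviation_ode (U w J : R -> R) (C t : R) :
  is_derive t 1 U ((U t + w t) * (U t + w t - t)) ->
  is_derive t 1 J (t * expR (- 2^-1 * t ^+ 2) * w t) ->
  let I r := expR (2^-1 * r ^+ 2) * (C - J r) in
  let Z r := U r - r + I r in
  is_derive t 1 Z ((Z t + (w t - I t)) ^+ 2 + t * Z t - 1).
Proof.
move=> dU dJ I Z.
have dI := is_derive_mul (is_derive_gauss 2^-1 t)
  (is_derive_sub (is_derive_cst C t (1 : R)) dJ).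
have dZ := is_derive_add (is_derive_sub dU (is_derive_id t (1 : R))) dI.
apply: (is_derive_eq dZ) => /=.
have E : expR (2^-1 * t ^+ 2) * expR (- 2^-1 * t ^+ 2) = 1.
  by rewrite -expRD mulNr subrr expR0.
have -> : expR (2^-1 * t ^+ 2) * (0 - t * expR (- 2^-1 * t ^+ 2) * w t) = - (t * w t).
  rewrite -[RHS]mulr1 -[X in _ = _ * X]E.
  by set a := expR (2^-1 * _); set b := expR (- 2^-1 * _); ring.
by rewrite /Z /I; set a := expR _; field.
Qed.

(** * Explosion or global existence, according to the sign of Z(s) *)

Section dichotomy.
Variables (s x C : R) (f : R -> \bar R) (w J : R -> R).
Hypothesis s0 : 0 < s.
Hypothesis cf : {within `[s, +oo[, continuous f}.
Hypothesis cw : continuous w.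
Hypothesis Js : J s = 0.
Hypothesis fs : f s = x%:E.
Hypothesis dJ :
  forall r, s <= r -> is_derive r 1 J (r * expR (- 2^-1 * r ^+ 2) * w r).
Hypothesis hC : forall t, s <= t ->
  `|w t - expR (2^-1 * t ^+ 2) * (C - J t)| <= 1.
Hypothesis eqf : forall t, s <= t -> (t%:E < blowup_time s f)%E ->
  f t = (x + (\int[mu]_(u in `[s, t]) (fine (f u) * (fine (f u) - u))) + w t)%:E.

Lemma blowup_finite : s^-1 < x - s + expR (2^-1 * s ^+ 2) * C ->
  (blowup_time s f < +oo)%E.
Proof.
move=> hx; rewrite ltey; apply/negP => /eqP binf.
have ch : continuous (fun u : R => Num.max s u).
  by move=> u; apply: continuous_max; [exact: cvg_cst|exact: cvg_id].
have [|u|U [Us hU]] := solution_smooth_part cf ch _ _ eqf.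
- by move=> u; rewrite le_max lexx.
- by rewrite binf ltry.
pose I r := expR (2^-1 * r ^+ 2) * (C - J r).
pose Z r := U r - r + I r.
apply: (@ode_explodes _ Z (fun t => w t - I t) s s0) => [t st|t st|].
- have [|_ dU] := hU t st; first by move=> u /andP[su _]; apply/max_r.
  exact: (deviation_ode C dU (dJ st)).
- exact: hC.
- by rewrite /Z /I Us Js subr0.
Qed.

Lemma blowup_infinite : x - s + expR (2^-1 * s ^+ 2) * C <= 0 ->
  blowup_time s f = +oo%E.
Proof.
move=> hx; apply/eqP; rewrite -leye_eq leNgt; apply/negP => bfin.
have sb := blowup_time_ge s f.
have [b bE] : exists b, blowup_time s f = b%:E.
  by move: bfin sb; case: (blowup_time s f) => // b; exists b.
have {}sb : s <= b by rewrite -lee_fin -bE.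
have [M hM] : exists M, forall t, s <= t <= b -> - M <= w t.
  have [c _ hc] := EVT_min sb (continuous_subspaceT cw).
  by exists (- w c) => t ht; rewrite opprK hc// in_itv.
(* If the blow-up time b were finite, X would be bounded before it. From above, Z <= 0 gives X <= t
   + D <= b + 1. From below, X (X - t) >= -t^2/4 >= -b^2/4 bounds the drift over a time at most b,
   and w >= -M. *)
pose K := `|x| + `|b| + 1 + `|M| + b * (b ^+ 2 / 4).
have b0 : 0 <= b by rewrite (le_trans (ltW s0)).
suff hK u : s <= u -> u < b \/ u = s -> (`|f u| <= K%:E)%E.
  by have := lt_blowup_extend cf sb hK; rewrite bE ltxx.
have b3 : 0 <= b * (b ^+ 2 / 4) by rewrite mulr_ge0 ?divr_ge0 ?sqr_ge0.
have := normr_ge0 M; have := normr_ge0 x; have := normr_ge0 b => nb nx nM.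
move=> su [ub|->]; last first.
  rewrite fs /= lee_fin /K; lra.
pose h r := Num.max s (Num.min r u).
have ch : continuous (fun r => Num.max s (Num.min r u)).
  have cm : continuous (fun r : R => Num.min r u).
    by move=> r; apply: continuous_min; [exact: cvg_id|exact: cvg_cst].
  by move=> r; exact: (@continuous_max R R (cst s) (fun q => Num.min q u) r (cvg_cst _) (cm r)).
have hu r : h r <= u by rewrite /h ge_max su /= ge_min lexx orbT.
have [r|r|U [Us hU]] := solution_smooth_part cf ch _ _ eqf.
- by rewrite le_max lexx.
- by rewrite bE lte_fin (le_lt_trans (hu r)).
have {}hU r : s <= r <= u -> f r = (U r + w r)%:E /\
      is_derive r 1 U ((U r + w r) * (U r + w r - r)).
  move=> /andP[sr ru]; apply: hU => // q /andP[sq qr].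
  by rewrite /h min_l ?max_r// (le_trans qr).
pose I r := expR (2^-1 * r ^+ 2) * (C - J r).
pose Z r := U r - r + I r.
have Zu : Z u <= 0.
  apply: (@ode_nonpos_preserved _ Z (fun t => w t - I t) s u (ltW s0) su).
  - move=> t ht; have [_ dU] := hU t ht; case/andP: ht => st _.
    exact: (deviation_ode C dU (dJ st)).
  - by move=> t /andP[st _]; exact: hC.
  - by rewrite /Z /I Us Js subr0.
have suu : s <= u <= u by rewrite su lexx.
have [fu _] := hU u suu.
have := hC su; rewrite ler_norml => /andP[_ Du].
have up : U u + w u <= b + 1.
  move: Zu; rewrite /Z /I; lra.
have low : U s + s * (b ^+ 2 / 4) <= U u + u * (b ^+ 2 / 4).
  have dV r : s <= r <= u -> is_derive r 1 (fun r => U r + r * (b ^+ 2 / 4))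
     ((U r + w r) * (U r + w r - r) + b ^+ 2 / 4).
    move=> hr; have [_ dU] := hU r hr.
    have d2 := is_derive_mul (is_derive_id r (1 : R)) (is_derive_cst (b ^+ 2 / 4) r (1 : R)).
    by apply: (is_derive_eq (is_derive_add dU d2)) => /=; ring.
  apply: (is_derive_le su dV) => r /andP[sr ru].
  have := sqr_ge0 (U r + w r - r / 2).
  have : r ^+ 2 <= b ^+ 2 by rewrite ler_sqr ?nnegrE// ?(le_trans (ltW s0) (ltW sr))// ltW// (lt_trans ru).
  nra.
have wu := hM u _; rewrite su (ltW ub) in wu; have {}wu := wu isT.
rewrite fu /= lee_fin /K ler_norml.
have xb : - `|x| <= x by rewrite lerNl -normrN ler_norm.
have Mb := ler_norm M.
have bb := ler_norm b.
have ub2 : u * (b ^+ 2 / 4) <= b * (b ^+ 2 / 4).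
  by rewrite ler_wpM2r ?divr_ge0 ?sqr_ge0// ltW.
have sb2 : 0 <= s * (b ^+ 2 / 4) by rewrite mulr_ge0 ?divr_ge0 ?sqr_ge0// ltW.
rewrite Us in low.
apply/andP; split; lra.
Qed.

End dichotomy.
End paths.

(** * Gaussian laws *)

Section gaussian_law.
Variable R : realType.
Local Notation mu := (@lebesgue_measure R).

Lemma measure_eq_Nyc (m1 m2 : {measure set (measurableTypeR R) -> \bar R}) :
  (m1 setT < +oo)%E -> (forall b : R, m1 `]-oo, b]%classic = m2 `]-oo, b]%classic) ->
  forall A : set R, measurable A -> m1 A = m2 A.
Proof.
move=> m1fin m12 A mA.
have fin1 (X : set (measurableTypeR R)) : measurable X -> (m1 X < +oo)%E.
  by move=> mX; apply: le_lt_trans m1fin; apply: le_measure; rewrite ?inE.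
apply: (@measure_unique _ _ (measurableTypeR R) (@ocitv R)
  (fun n : nat => `](- n%:R), n%:R]%classic)) => //.
- exact: ocitvI.
- move=> n; exact: is_ocitv.
- apply/seteqP; split => // x _; exists (Num.truncn `|x|).+1 => //=.
  have := truncnS_gt `|x|; rewrite in_itv /= ltr_norml => /andP[h1 h2].
  by rewrite h1 ltW.
- move=> X /ocitvP[->|[[a b] /= ab ->]]; first by rewrite !measure0.
  have -> : `]a, b]%classic = `]-oo, b]%classic `\` `]-oo, a]%classic :> set R.
    apply/seteqP; split=> x /=; rewrite !in_itv /=.
      by move=> /andP[ax ->]; split=> //; apply/negP; rewrite -ltNge.
    by move=> [-> /negP]; rewrite -ltNge => ->.
  have sub : `]-oo, b]%classic `&` `]-oo, a]%classic = `]-oo, a]%classic :> set R.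
    rewrite setIC; apply/setIidPl => x /=; rewrite !in_itv /= => xa.
    by rewrite (le_trans xa)// ltW.
  have m2b : (m2 `]-oo, b]%classic < +oo)%E by rewrite -m12; exact: fin1.
  rewrite [LHS]measureD//; last exact: fin1.
  by rewrite [RHS]measureD// sub; congr (_ - _)%E; exact: m12.
- move=> n; apply: fin1; exact: measurable_itv.
Qed.

Lemma normal_pdfE0 (s x : R) : s != 0 ->
  normal_pdf 0 s x = normal_peak s * expR (- x ^+ 2 / (s ^+ 2 *+ 2)).
Proof. by move=> s0; rewrite normal_pdfE// /normal_fun subr0. Qed.

Lemma normal_pdf_scale (c s x : R) : 0 < c -> 0 < s ->
  normal_pdf 0 (c * s) (c * x) * c = normal_pdf 0 s x.
Proof.
move=> c0 s0; rewrite !normal_pdfE0 ?gt_eqF ?mulr_gt0//.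
have -> : - (c * x) ^+ 2 / ((c * s) ^+ 2 *+ 2) = - x ^+ 2 / (s ^+ 2 *+ 2).
  by field; rewrite !gt_eqF.
rewrite mulrAC; congr (_ * _); rewrite /normal_peak.
have -> : (c * s) ^+ 2 * pi *+ 2 = c ^+ 2 * (s ^+ 2 * pi *+ 2).
  by rewrite mulrnAr exprMn mulrA.
rewrite sqrtrM ?sqr_ge0// sqrtr_sqr gtr0_norm// invfM mulrAC mulVf ?mul1r//.
by rewrite gt_eqF.
Qed.

Lemma normal_prob_Nyc_scale (c s b : R) : 0 < c -> 0 < s ->
  normal_prob 0 (c * s) `]-oo, c * b]%classic = normal_prob 0 s `]-oo, b]%classic.
Proof.
move=> c0 s0; rewrite /normal_prob.
have cs0 : c * s != 0 by rewrite gt_eqF ?mulr_gt0.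
pose F x := c * x.
have dF (x : R) : is_derive x 1 F c.
  have := is_derive_mul (is_derive_cst c x (1 : R)) (is_derive_id x (1 : R)).
  by move=> d; apply: (is_derive_eq d); rewrite /=; ring.
have F' : F^`()%classic = cst c.
  by apply/funext => x; rewrite derive1E; case: (dF x).
have cF : continuous F by move=> x; apply: cvgM; [exact: cvg_cst|exact: cvg_id].
rewrite (@increasing_ge0_integration_by_substitutionNy _ F (normal_pdf 0 (c * s)) b).
- apply: eq_integral => x _; congr EFin.
  by rewrite F' -(normal_pdf_scale x c0 s0).
- by move=> x y _ _ xy; rewrite /F ltr_pM2l.
- by rewrite F' => x _; exact: cst_continuous.
- by rewrite F'; exact: is_cvg_cst.
- by rewrite F'; exact: cvg_cst.
- split; first by move=> x _; case: (dF x).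
  exact: cvg_at_left_filter (cF b).
- by apply: gt0_cvgMrNy => //; exact: cvg_id.
- apply: continuous_subspaceT; exact: continuous_normal_pdf.
- by move=> x _; exact: normal_pdf_ge0.
Qed.

(** By [measure_eq_Nyc] half-lines suffice, and there it is a substitution in the density. *)
Lemma normal_prob_scale (c s : R) (A : set R) : 0 < c -> 0 < s -> measurable A ->
  normal_prob 0 s ((fun x => c * x) @^-1` A) = normal_prob 0 (c * s) A.
Proof.
move=> c0 s0 mA.
have mc : measurable_fun setT (fun x : measurableTypeR R => (c * x : measurableTypeR R)).
  exact: mulrl_measurable.
pose m := @normal_prob R 0 s : probability (measurableTypeR R) R.
apply: (@measure_eq_Nyc (measure_function_pushforward__canonical__measure_function_Measure m mc)
   (@normal_prob R 0 (c * s))) => //.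
  by rewrite /= /pushforward preimage_setT probability_setT ltry.
move=> b /=; rewrite /pushforward.
have -> : (fun x => c * x) @^-1` `]-oo, b]%classic = `]-oo, c^-1 * b]%classic.
  by apply/seteqP; split=> x /=; rewrite !in_itv /= ler_pdivlMl.
rewrite -[X in _ = normal_prob _ _ `]-oo, X]%classic](@mulVKf _ c) ?gt_eqF//.
by rewrite normal_prob_Nyc_scale.
Qed.

Lemma normal_prob_Phi (z : R) : normal_prob 0 1 `]-oo, z]%classic = (Phi z)%:E.
Proof.
rewrite /normal_prob /Phi.
have -> : (\int[mu]_(x in `]-oo, z]) (normal_pdf 0 1 x)%:E =
  \int[mu]_(x in `]-oo, z]) ((Num.sqrt (2 * pi))^-1%:E * (expR (- (x ^+ 2 / 2)))%:E))%E.
  apply: eq_integral => x _; rewrite normal_pdfE0// -EFinM; congr (_ * expR _)%:E.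
    by rewrite /normal_peak expr1n mul1r -mulr_natl.
  by rewrite expr1n mulNr.
have int_pdf : mu.-integrable `]-oo, z] (fun x => (expR (- (x ^+ 2 / 2)))%:E).
  have pk : normal_peak (1 : R) != 0 by rewrite gt_eqF// normal_peak_gt0.
  have -> : (fun x => (expR (- (x ^+ 2 / 2)))%:E) =
      (fun x => (normal_peak (1 : R))^-1%:E * (normal_pdf 0 1 x)%:E)%E.
    apply/funext => x; rewrite normal_pdfE0// -EFinM mulKf//.
    by rewrite expr1n mulNr.
  apply: integrableZl => //.
  by apply: integrableS (integrable_normal_pdf 0 1).
rewrite integralZl// EFinM; congr (_ * _)%E.
by rewrite /Rintegral fineK//; exact: integrable_fin_num.
Qed.

Lemma normal_prob_cyE (a : R) : normal_prob 0 1 `[a, +oo[%classic = (Phi (- a))%:E.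
Proof.
rewrite -normal_prob_Phi /normal_prob.
rewrite (@ge0_integration_by_substitutionNy _ (normal_pdf 0 1) a).
- apply: eq_integral => x _ /=; rewrite !normal_pdfE0//.
  by rewrite sqrrN.
- by apply: continuous_subspaceT; exact: continuous_normal_pdf.
- by move=> x _; exact: normal_pdf_ge0.
Qed.

Lemma normal_prob_cy (s a : R) : 0 < s ->
  normal_prob 0 s `[a, +oo[%classic = (Phi (- a / s))%:E.
Proof.
move=> s0; rewrite mulNr -normal_prob_cyE -[X in normal_prob _ X]mulr1.
rewrite -normal_prob_scale//.
congr (normal_prob 0 1 _); apply/seteqP; split=> x /=; rewrite !in_itv /= !andbT.
  by rewrite ler_pdivrMr// mulrC.
by rewrite ler_pdivrMr// mulrC.
Qed.

Lemma Phi_le (a b : R) : a <= b -> Phi a <= Phi b.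
Proof.
move=> ab; rewrite -lee_fin -!normal_prob_Phi.
apply: (@ge0_subset_integral _ _ _ mu) => //.
- by apply/measurable_EFinP; apply: measurable_funTS; exact: measurable_normal_pdf.
- by move=> x _; rewrite lee_fin normal_pdf_ge0.
- by move=> x /=; rewrite !in_itv /= => /le_trans; apply.
Qed.

(** The density is at most 1/sqrt(2 pi) <= 1; this crude constant is enough for the continuity of
    [Phi]. *)
Lemma Phi_lipschitz (a b : R) : a <= b -> Phi b <= Phi a + (b - a).
Proof.
move=> ab; rewrite -lee_fin EFinD -!normal_prob_Phi.
have -> : `]-oo, b]%classic = `]-oo, a]%classic `|` `]a, b]%classic :> set R.
  apply/seteqP; split=> x /=; rewrite !in_itv /=.
    by move=> xb; have [xa|ax] := leP x a; [left|right].
  by move=> [xa|/andP[]//]; rewrite (le_trans xa).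
pose m := @normal_prob R 0 1 : probability (measurableTypeR R) R.
apply: (le_trans (measureU2 m _ _)) => //.
rewrite leeD2l// /m /= /normal_prob.
apply: (@le_trans _ _ (\int[mu]_(x in `]a, b]) 1%:E)%E).
  apply: ge0_le_integral => //.
  - by move=> x _; rewrite lee_fin normal_pdf_ge0.
  - by apply/measurable_EFinP; apply: measurable_funTS; exact: measurable_normal_pdf.
  - move=> x _; rewrite lee_fin (le_trans (normal_pdf_ub _ _ _))//.
    rewrite /normal_peak expr1n mul1r.
    have p1 : 1 <= (pi : R) *+ 2.
      by move: (pi : R) (pi_ge2 R) => p p2; rewrite -mulr_natr; lra.
    rewrite invf_le1 ?sqrtr_gt0 ?(lt_le_trans ltr01)//.
    by rewrite -[X in X <= _]sqrtr1 ler_wsqrtr.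
rewrite (integral_cst mu _ 1%E)//.
rewrite mul1e; apply: (eq_ind_r (fun u => (u <= _)%E) _ (lebesgue_measure_itv _)).
by rewrite /= lte_fin; case: ltP => // _; rewrite lee_fin subr_ge0.
Qed.

Lemma Phi_continuous : continuous (@Phi R).
Proof.
move=> x; apply/cvgrPdist_le => e e0.
near=> y.
have : `|x - y| <= e by near: y; exact: cvgr_dist_le.
have [xy|/ltW yx] := leP x y.
  rewrite distrC ger0_norm ?subr_ge0// distrC ger0_norm ?subr_ge0 ?Phi_le//.
  by have := Phi_lipschitz xy; lra.
rewrite ger0_norm ?subr_ge0// ger0_norm ?subr_ge0 ?Phi_le//.
by have := Phi_lipschitz yx; lra.
Unshelve. all: by end_near. Qed.

(* Completing the square, the density at x >= a is at most exp(-a^2/(2s^2))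
   times the density of the normal law centred at a. *)
Lemma normal_prob_tail (s a : R) : 0 < s -> 0 <= a ->
  (normal_prob 0 s [set x | (a < `|x|)%R] <= (2 * expR (- a ^+ 2 / (s ^+ 2 *+ 2)))%:E)%E.
Proof.
move=> s0 a0.
have s0' : s != 0 by rewrite gt_eqF.
pose m := @normal_prob R 0 s : probability (measurableTypeR R) R.
have half (b : R) (D : set R) : measurable D -> b ^+ 2 = a ^+ 2 ->
   (forall x, D x -> a ^+ 2 <= b * x) ->
   (m D <= (expR (- a ^+ 2 / (s ^+ 2 *+ 2)))%:E)%E.
  move=> mD ba hD.
  apply: (@le_trans _ _ (\int[mu]_(x in D)
     ((expR (- a ^+ 2 / (s ^+ 2 *+ 2)))%:E * (normal_pdf b s x)%:E))%E).
    apply: ge0_le_integral => //.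
    - by move=> x _; rewrite lee_fin normal_pdf_ge0.
    - by apply/measurable_EFinP; apply: measurable_funTS; exact: measurable_normal_pdf.
    - apply/measurable_EFinP; apply: measurable_funTS.
      by apply: measurable_funM => //; exact: measurable_normal_pdf.
    - move=> x Dx; rewrite -EFinM lee_fin !normal_pdfE// /normal_fun.
      rewrite mulrCA ler_wpM2l ?normal_peak_ge0// -expRD ler_expR -mulrDl.
      rewrite ler_pM2r ?invr_gt0 ?mulrn_wgt0 ?exprn_gt0//.
      by have := hD x Dx; rewrite subr0 sqrrB -mulr_natr; nra.
  rewrite ge0_integralZl//.
  - rewrite -[leRHS]mule1 lee_wpmul2l ?lee_fin ?expR_ge0//.
    exact: (probability_le1 (@normal_prob R b s : probability (measurableTypeR R) R)).
  - by apply/measurable_EFinP; apply: measurable_funTS; exact: measurable_normal_pdf.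
  - by move=> x _; rewrite lee_fin normal_pdf_ge0.
have -> : [set x : R | a < `|x|] = `]a, +oo[%classic `|` `]-oo, (- a)[%classic.
  apply/seteqP; split=> x /=; rewrite !in_itv /= ?andbT.
    by rewrite lter_normr => /orP[ax|ax]; [left|right; lra].
  by rewrite lter_normr => -[->//|ax]; apply/orP; right; lra.
apply: (le_trans (measureU2 m _ _)) => //.
rewrite mulrDl mul1r EFinD leeD//.
  apply: (half a) => // x; rewrite /= in_itv /= andbT => ax.
  by rewrite expr2 ler_wpM2l// ltW.
apply: (half (- a)) => //; first by rewrite sqrrN.
move=> x; rewrite /= in_itv /= => ax.
by rewrite mulNr -mulrN expr2 ler_wpM2l// ltW// ltrNr.
Qed.

End gaussian_law.

(** * Laws of sums of independent increments *)

Section independent_sums.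
Context (R : realType) (d : measure_display) (T : measurableType d)
  (P : probability T R).

(** Rectangles form a generating pi-system of the plane. The events E and F, carried along by
    restricting P, hold the conditions on the other variables in the induction of [eq_law_sum]. *)
Lemma eq_law_pair (X1 X2 Y1 Y2 : T -> R) (E F : set T) :
  measurable_fun setT X1 -> measurable_fun setT X2 ->
  measurable_fun setT Y1 -> measurable_fun setT Y2 ->
  measurable E -> measurable F ->
  (forall A B : set R, measurable A -> measurable B ->
    P (X1 @^-1` A `&` X2 @^-1` B `&` E) = P (Y1 @^-1` A `&` Y2 @^-1` B `&` F)) ->
  forall S : set (R * R), measurable S ->
    P ((fun w => (X1 w, X2 w)) @^-1` S `&` E) =
    P ((fun w => (Y1 w, Y2 w)) @^-1` S `&` F).
Proof.
move=> mX1 mX2 mY1 mY2 mE mF H S mS.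
have mX := measurable_fun_pair mX1 mX2.
have mY := measurable_fun_pair mY1 mY2.
pose G : set (set (R * R)) := [set A `*` B | A in measurable & B in measurable].
have GX (g : T -> R * R) (D : set T) (mD : measurable D)
    (mg : measurable_fun setT g) (A : set (R * R)) :
    measure_function_pushforward__canonical__measure_function_Measure
      (mrestr P mD) mg A = P (g @^-1` A `&` D) by [].
rewrite -(GX _ _ mE mX) -(GX _ _ mF mY).
apply: (@measure_unique _ _ _ G (fun=> setT)) => //.
- exact: measurable_prod_measurableType.
- move=> _ _ [A1 mA1 [B1 mB1 <-]] [A2 mA2 [B2 mB2 <-]].
  exists (A1 `&` A2); first exact: measurableI.
  by exists (B1 `&` B2); [exact: measurableI|rewrite setXI].
- by move=> _; exists setT => //; exists setT => //; rewrite setXTT.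
- by apply/seteqP; split => // x _; exists 0%N.
- move=> _ [A mA [B mB <-]]; rewrite !GX.
  exact: H.
- by move=> _; rewrite GX preimage_setT setTI (le_lt_trans (probability_le1 P _))// ltry.
Qed.

Lemma eq_law_sum (n : nat) (X Y : nat -> T -> R) :
  (forall i, measurable_fun setT (X i)) -> (forall i, measurable_fun setT (Y i)) ->
  (forall A : nat -> set R, (forall i, measurable (A i)) ->
    P (\bigcap_(i < n.+1) X i @^-1` A i) = P (\bigcap_(i < n.+1) Y i @^-1` A i)) ->
  forall B : set R, measurable B ->
    P ((fun w => \sum_(i < n.+1) X i w) @^-1` B) =
    P ((fun w => \sum_(i < n.+1) Y i w) @^-1` B).
Proof.
elim: n X Y => [|n IH] X Y mX mY H B mB.
  have := H (fun=> B) (fun=> mB); rewrite !bigcap_mkord !big_ord1.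
  have E (Z : nat -> T -> R) : (fun w => \sum_(i < 1) Z i w) = Z 0%N.
    by apply/funext => w; rewrite big_ord1.
  by rewrite !E.
(* Induction on the number of terms: the last two are added into one variable. The hypothesis for
   the merged family concerns the event that X_n + X_(n+1) lies in A_n, which is not a rectangle;
   hence [eq_law_pair]. *)
pose merge (Z : nat -> T -> R) (i : nat) : T -> R :=
  if i == n then (fun w => Z n w + Z n.+1 w) else Z i.
have sumE (Z : nat -> T -> R) : (fun w => \sum_(i < n.+2) Z i w) =
    (fun w => \sum_(i < n.+1) merge Z i w).
  apply/funext => w; rewrite !big_ord_recr /= /merge eqxx addrA; congr (_ + _ + _).
  by apply: eq_bigr => i _; rewrite ifN// neq_ltn ltn_ord.
have mmerge (Z : nat -> T -> R) : (forall i, measurable_fun setT (Z i)) ->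
    forall i, measurable_fun setT (merge Z i).
  move=> mZ i; rewrite /merge; case: ifP => // _.
  exact: measurable_funD.
rewrite !sumE; apply: IH => //; [exact: mmerge|exact: mmerge|].
move=> A mA.
pose E (Z : nat -> T -> R) := \big[setI/setT]_(i < n) (Z i @^-1` A i).
have mE (Z : nat -> T -> R) : (forall i, measurable_fun setT (Z i)) -> measurable (E Z).
  move=> mZ; apply: bigsetI_measurable => i _.
  by rewrite -[X in measurable X]setTI; exact: mZ.
have capE (Z : nat -> T -> R) : \bigcap_(i < n.+1) merge Z i @^-1` A i =
    (fun w => (Z n w, Z n.+1 w)) @^-1` [set p | A n (p.1 + p.2)] `&` E Z.
  rewrite bigcap_mkord big_ord_recr /= setIC /merge eqxx; congr (_ `&` _).
  by apply: eq_bigr => i _; rewrite ifN// neq_ltn ltn_ord.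
rewrite !capE; apply: eq_law_pair => //; [exact: mE|exact: mE| |].
- move=> C D mC mD.
  pose A' (i : nat) := if (i < n)%N then A i else if i == n then C else D.
  have mA' i : measurable (A' i) by rewrite /A'; case: ifP => // _; case: ifP.
  have capE' (Z : nat -> T -> R) : \bigcap_(i < n.+2) Z i @^-1` A' i =
      Z n @^-1` C `&` Z n.+1 @^-1` D `&` E Z.
    rewrite bigcap_mkord !big_ord_recr /= {2 3}/A' ltnn eqxx ltnNge leqnSn /=.
    rewrite -[n.+1 == n]negbK neq_ltn ltnSn orbT /= -setIA setIC; congr (_ `&` _).
    by apply: eq_bigr => i _; rewrite /A' ltn_ord.
  by have := H A' mA'; rewrite !capE'.
- have mD : measurable_fun setT (fun p : R * R => p.1 + p.2).
    by apply: measurable_funD.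
  rewrite -[X in measurable X]setTI.
  exact: (mD measurableT _ (mA n)).
Qed.

(* The weighted increments c_i (W(u_{i+1}) - W(u_i)) have the joint law of the
   increments of W along the times v_i, so that their sum has the law of
   W(v_n) - W(0). *)
Lemma wiener_weighted_sum (W : R -> {RV P >-> R}) (n : nat) (u c : nat -> R) :
  wiener_process W -> 0 <= u 0%N -> (forall i, u i < u i.+1) ->
  (forall i, 0 < c i) -> forall B : set R, measurable B ->
  P ((fun w => \sum_(i < n.+1) c i * (W (u i.+1) w - W (u i) w)) @^-1` B) =
  normal_prob 0 (Num.sqrt (\sum_(i < n.+1) c i ^+ 2 * (u i.+1 - u i))) B.
Proof.
move=> hW u0 uS c0 B mB.
(* The partial variances serve as new times. Comparing with increments of W itself, whose sum
   telescopes, replaces a convolution of normal laws. *)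
pose v k := \sum_(i < k) c i ^+ 2 * (u i.+1 - u i).
have vS k : v k.+1 - v k = c k ^+ 2 * (u k.+1 - u k).
  by rewrite /v big_ord_recr /= addrAC subrr add0r.
have v0 : v 0%N = 0 by rewrite /v big_ord0.
have vlt k : v k < v k.+1.
  by rewrite -subr_gt0 vS mulr_gt0 ?exprn_gt0 ?subr_gt0.
have vge k : 0 <= v k.
  by elim: k => [|k]; [rewrite v0|move=> /le_trans; apply; exact: ltW].
have uge k : 0 <= u k by elim: k => // k /le_trans; apply; exact: ltW.
have mW t : measurable_fun setT (W t : T -> R) by exact: measurable_funPT.
have mD s t : measurable_fun setT (fun w => W t w - W s w) by exact: measurable_funB.
rewrite (@eq_law_sum n (fun i w => c i * (W (u i.+1) w - W (u i) w))
  (fun i w => W (v i.+1) w - W (v i) w))//; last 2 first.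
- by move=> i; apply: measurable_funM.
- move=> A mA.
  have mcA i : measurable ((fun x : R => c i * x) @^-1` A i).
    rewrite -[X in measurable X]setTI.
    have mc : measurable_fun setT (fun x : R => c i * x) by exact: mulrl_measurable.
    exact: mc.
  have := wiener_independent hW n.+1 u0 (fun i => ltW (uS i)) mcA.
  have v00 : 0 <= v 0%N by rewrite v0.
  have := wiener_independent hW n.+1 v00 (fun i => ltW (vlt i)) mA.
  move=> -> E; transitivity (P (\bigcap_(i < n.+1)
      (fun w => W (u i.+1) w - W (u i) w) @^-1` ((fun x => c i * x) @^-1` A i))) => //.
  rewrite E; apply: eq_bigr => i _.
  have := wiener_gaussian hW (uge i) (uS i) (mcA i).
  have := wiener_gaussian hW (vge i) (vlt i) (mA i).
  rewrite /pushforward => -> ->.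
  have si : 0 < Num.sqrt (u i.+1 - u i) by rewrite sqrtr_gt0 subr_gt0.
  rewrite (normal_prob_scale (c0 i) si (mA i)) vS; congr (normal_prob 0 _ _).
  by rewrite sqrtrM ?sqr_ge0// sqrtr_sqr gtr0_norm.
have -> : (fun w => \sum_(i < n.+1) (W (v i.+1) w - W (v i) w)) =
    (fun w => W (v n.+1) w - W 0 w).
  apply/funext => w; rewrite -(big_mkord predT (fun i => W (v i.+1) w - W (v i) w)).
  by rewrite (telescope_sumr (fun i => W (v i) w))// v0.
have vn : 0 < v n.+1 by rewrite -v0 (le_lt_trans _ (vlt n))// v0.
by have := wiener_gaussian hW (lexx 0) vn mB; rewrite /pushforward subr0.
Qed.

(** The weights [p] split a total budget [a]. It is applied twice, with 2^-(n+1) over the dyadic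
    levels and with 1/(j+1) - 1/(j+2) over the cells of one level, so that infinitely many cells
    cost no more than the prefactor. *)
Lemma union_bound (B : nat -> set T) (p : nat -> R) (a : R) :
  (forall n, measurable (B n)) -> 0 <= a ->
  (forall n, (P (B n) <= (a * p n)%:E)%E) ->
  (forall N, \sum_(n < N) p n <= 1) -> (P (\bigcup_n B n) <= a%:E)%E.
Proof.
move=> mB a0 hB hp.
apply: (@le_trans _ _ (\sum_(n <oo) P (B n))%E).
  by apply: measure_sigma_subadditive => //; exact: bigcup_measurable.
apply: lime_le; first by apply: is_cvg_nneseries => n _ _; exact: measure_ge0.
apply: nearW => N.
apply: (@le_trans _ _ (\sum_(0 <= n < N) (a * p n)%:E)%E).
  by apply: lee_sum => n _; exact: hB.
rewrite big_mkord sumEFin lee_fin -mulr_sumr.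
by rewrite -[leRHS]mulr1 ler_wpM2l.
Qed.

End independent_sums.

(** * Increments of the Wiener process *)

Section bad_increments.
Context (R : realType) (d : measure_display) (T : measurableType d)
  (P : probability T R) (W : R -> {RV P >-> R}).
Hypothesis hW : wiener_process W.

Lemma wiener_increment_tail (a b l : R) : 0 <= a -> a < b -> 0 <= l ->
  (P [set w | (l < `|W b w - W a w|)%R] <=
    (2 * expR (- l ^+ 2 / ((b - a) *+ 2)))%:E)%E.
Proof.
move=> a0 ab l0.
have ba : 0 < b - a by rewrite subr_gt0.
have mA : measurable [set x : R | l < `|x|].
  have -> : [set x : R | l < `|x|] = Num.norm @^-1` `]l, +oo[%classic.
    by apply/seteqP; split => x /=; rewrite in_itv /= andbT.
  rewrite -[X in measurable X]setTI.
  have mn : measurable_fun setT (fun x : R => `|x|) by exact: normr_measurable.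
  exact: mn.
have := wiener_gaussian hW a0 ab mA.
have := normal_prob_tail (s := Num.sqrt (b - a)) _ l0.
by rewrite sqrtr_gt0 sqr_sqrtr ?(ltW ba)// /pushforward => /(_ ba) + E; rewrite -E.
Qed.

Lemma sum_halves_le1 (N : nat) : \sum_(n < N) (2^-1 : R) ^+ n.+1 <= 1.
Proof.
suff -> : \sum_(n < N) (2^-1 : R) ^+ n.+1 = 1 - 2^-1 ^+ N.
  by rewrite gerBl exprn_ge0.
elim: N => [|N IH]; first by rewrite big_ord0 expr0 subrr.
by rewrite big_ord_recr /= IH exprS; field.
Qed.

Lemma sum_inv_consecutive_le1 (N : nat) :
  \sum_(j < N) ((j.+1%:R : R)^-1 - (j.+2%:R)^-1) <= 1.
Proof.
suff -> : \sum_(j < N) ((j.+1%:R : R)^-1 - (j.+2%:R)^-1) = 1 - (N.+1%:R)^-1.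
  by rewrite gerBl invr_ge0.
elim: N => [|N IH]; first by rewrite big_ord0 invr1 subrr.
by rewrite big_ord_recr /= IH; ring.
Qed.

(* The time t such that (t^2 - s^2)/2 = r. *)
Definition clock (s r : R) : R := Num.sqrt (s ^+ 2 + 2 * r).

Lemma clock_sqr (s r : R) : 0 <= r -> clock s r ^+ 2 = s ^+ 2 + 2 * r.
Proof. by move=> r0; rewrite sqr_sqrtr// addr_ge0 ?sqr_ge0 ?mulr_ge0. Qed.

Lemma clock0 (s : R) : 0 <= s -> clock s 0 = s.
Proof. by move=> s0; rewrite /clock mulr0 addr0 sqrtr_sqr ger0_norm. Qed.

Lemma clock_ge (s r : R) : 0 <= s -> 0 <= r -> s <= clock s r.
Proof.
move=> s0 r0; rewrite -[leLHS](ger0_norm s0) -sqrtr_sqr ler_wsqrtr//.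
by rewrite lerDl mulr_ge0.
Qed.

Lemma clock_lt (s r r' : R) : 0 <= r -> r < r' -> clock s r < clock s r'.
Proof.
move=> r0 rr'; rewrite ltr_sqrt; last first.
  by rewrite ltr_wpDl ?sqr_ge0// mulr_gt0// (le_lt_trans r0).
by rewrite ltrD2l ltr_pM2l.
Qed.

Lemma clock_diff (s r r' : R) : 0 < s -> 0 <= r -> r < r' ->
  (clock s r' - clock s r) * (clock s r' + clock s r) = 2 * (r' - r).
Proof.
move=> s0 r0 rr'; rewrite -subr_sqr !clock_sqr//; first by ring.
by rewrite (le_trans r0)// ltW.
Qed.

(* Since 2 (7/8)^2 = 49/32 > 1, the threshold outgrows the standard deviation of
   the increment geometrically in n.  The sixth power in exp(-y) <= (6/y)^6 is
   large enough for (49/32)^(6n) >= 8^n to absorb the factor 4^n coming from the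
   lower bound (j+1)/2^n on the squared clock. *)
Lemma wiener_bad_cell (k : R) (s : R) (n j : nat) : 0 < k -> 1 <= s ->
  (P [set w | (k * (7 / 8) ^+ n <
      `|W (clock s (j.+1%:R / 2 ^+ n)) w - W (clock s (j%:R / 2 ^+ n)) w|)%R]
  <= (8 * (12 / k ^+ 2) ^+ 6 / s ^+ 2 * 2^-1 ^+ n.+1 *
       ((j.+1%:R)^-1 - (j.+2%:R)^-1))%:E)%E.
Proof.
move=> k0 s1.
have s0 : 0 < s by rewrite (lt_le_trans ltr01).
have p0 : 0 < (2 : R) ^+ n by rewrite exprn_gt0.
set r := j%:R / 2 ^+ n; set r' := j.+1%:R / 2 ^+ n.
have r0 : 0 <= r by rewrite /r divr_ge0// ltW.
have rr' : r' - r = (2 ^+ n)^-1.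
  by rewrite /r' /r -mulrBl -natr1 addrAC subrr add0r mul1r.
have ltrr' : r < r' by rewrite -subr_gt0 rr' invr_gt0.
have cs : s <= clock s r by apply: clock_ge => //; exact: ltW.
have cr0 : 0 < clock s r by rewrite (lt_le_trans s0).
have clt := clock_lt s r0 ltrr'.
set q : R := 7 / 8.
have q0 : 0 < q by rewrite /q; lra.
have l0 : 0 <= k * q ^+ n by rewrite mulr_ge0 ?exprn_ge0 ?ltW.
apply: (le_trans (wiener_increment_tail (ltW cr0) clt l0)).
rewrite lee_fin.
have cd := clock_diff s0 r0 ltrr'.
set D := clock s r' - clock s r in cd *.
have D0 : 0 < D by rewrite subr_gt0.
have Dle : D * clock s r <= (2 ^+ n)^-1.
  rewrite rr' in cd; nra.
pose y := k ^+ 2 / 2 * (49 / 32) ^+ n * clock s r.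
have y0 : 0 < y by rewrite /y !mulr_gt0 ?exprn_gt0 ?invr_gt0 ?divr_gt0.
have yle : y <= (k * q ^+ n) ^+ 2 / (D *+ 2).
  rewrite ler_pdivlMr ?mulrn_wgt0// -mulr_natr.
  have -> : y * (D * 2) = k ^+ 2 * (49 / 32) ^+ n * (D * clock s r).
    by rewrite /y; field.
  apply: (@le_trans _ _ (k ^+ 2 * (49 / 32) ^+ n * (2 ^+ n)^-1)).
    by rewrite ler_wpM2l// mulr_ge0 ?sqr_ge0// exprn_ge0.
  rewrite [(k * _) ^+ 2]exprMn -mulrA ler_wpM2l ?sqr_ge0//.
  rewrite -exprVn -exprMn -exprM mulnC exprM.
  by rewrite lerXn2r ?nnegrE// /q; lra.
apply: (@le_trans _ _ (2 * (6 / y) ^+ 6)).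
  rewrite ler_wpM2l// mulNr.
  apply: (@le_trans _ _ (expR (- y))); first by rewrite ler_expR lerN2.
  rewrite expRN -[6 / y]invf_div exprVn lef_pV2 ?posrE ?expR_gt0 ?exprn_gt0 ?divr_gt0//.
  have -> : expR y = expR (y / 6) ^+ 6.
    by rewrite -expRM_natl; congr expR; rewrite -mulr_natr; field.
  rewrite lerXn2r ?nnegrE ?expR_ge0 ?divr_ge0 ?(ltW y0)//.
  by have := expR_ge1Dx (y / 6); lra.
(* One squared clock is bounded below by s^2, which produces the decay 1/s^2; the other two give
   (j+1)^2/4^n, which makes the bound summable over j. Here s >= 1 allows passing from j to j+1. *)
have c6 : s ^+ 2 * ((j.+1%:R / 2 ^+ n) ^+ 2) <= clock s r ^+ 6.
  have -> : clock s r ^+ 6 = clock s r ^+ 2 * (clock s r ^+ 2) ^+ 2 by ring.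
  rewrite ler_pM ?sqr_ge0//.
    by rewrite lerXn2r ?nnegrE ?(ltW s0) ?(ltW cr0).
  rewrite lerXn2r ?nnegrE ?sqr_ge0 ?divr_ge0 ?(ltW p0)//.
  rewrite clock_sqr// -/r' -[r'](subrK r) rr'.
  have : (2 ^+ n)^-1 <= 1 :> R by rewrite invf_le1// exprn_ege1// ler1n.
  nra.
have e6 : 8 ^+ n <= ((49 / 32 : R) ^+ n) ^+ 6.
  rewrite -exprM mulnC exprM lerXn2r ?nnegrE ?exprn_ge0//.
  have -> : (49 / 32 : R) ^+ 6 = ((49 / 32) ^+ 2) ^+ 3 by rewrite -exprM.
  have -> : 8 = 2 ^+ 3 :> R by ring.
  by rewrite lerXn2r ?nnegrE//; lra.
have E1 : (6 / y) ^+ 6 = (12 / k ^+ 2) ^+ 6 / (((49 / 32) ^+ n) ^+ 6 * clock s r ^+ 6).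
  rewrite -exprMn -expr_div_n; congr (_ ^+ 6); rewrite /y.
  by field; rewrite !gt_eqF ?exprn_gt0.
have E2 : (8 ^+ n * (s ^+ 2 * (j.+1%:R / 2 ^+ n) ^+ 2))^-1 =
    (s ^+ 2)^-1 * 2^-1 ^+ n * (j.+1%:R ^+ 2)^-1.
  have -> : 8 ^+ n = 2 ^+ n * 2 ^+ n * 2 ^+ n :> R.
    by rewrite -!exprMn; congr (_ ^+ n); ring.
  by rewrite exprVn; field; rewrite !gt_eqF.
have j2 : (j.+1%:R ^+ 2)^-1 <= 2 * ((j.+1%:R)^-1 - (j.+2%:R)^-1) :> R.
  have h1 : 0 < j.+1%:R :> R by [].
  have h2 : j.+2%:R = j.+1%:R + 1 :> R by rewrite natr1.
  have h3 : 1 <= j.+1%:R :> R by rewrite ler1n.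
  rewrite h2; move: (j.+1%:R : R) h1 h3 => x h1 h3.
  have -> : 2 * (x^-1 - (x + 1)^-1) = 2 / (x * (x + 1)).
    by field; rewrite !gt_eqF// ltr_wpDr.
  rewrite ler_pdivlMr ?mulr_gt0 ?ltr_wpDr// mulrC ler_pdivrMr ?exprn_gt0//.
  nra.
rewrite E1.
apply: (@le_trans _ _ (2 * ((12 / k ^+ 2) ^+ 6 *
    ((s ^+ 2)^-1 * 2^-1 ^+ n * (2 * ((j.+1%:R)^-1 - (j.+2%:R)^-1)))))); last first.
  rewrite [2^-1 ^+ n.+1]exprS.
  move: ((12 / k ^+ 2) ^+ 6) (s ^- 2) (2^-1 ^+ n) (_ - _) => A B C E.
  by rewrite le_eqVlt; apply/orP; left; apply/eqP; field.
rewrite ler_wpM2l// ler_wpM2l ?exprn_ge0 ?divr_ge0 ?sqr_ge0//.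
apply: (@le_trans _ _ ((s ^+ 2)^-1 * 2^-1 ^+ n * (j.+1%:R ^+ 2)^-1)); last first.
  by rewrite ler_wpM2l// mulr_ge0 ?invr_ge0 ?sqr_ge0 ?exprn_ge0.
rewrite -E2 lef_pV2 ?posrE.
- have h1 : 0 <= 8 ^+ n :> R by exact: exprn_ge0.
  have h2 : 0 <= s ^+ 2 * (j.+1%:R / 2 ^+ n) ^+ 2.
    by apply: mulr_ge0; exact: sqr_ge0.
  exact: ler_pM h1 h2 e6 c6.
- by rewrite mulr_gt0 ?exprn_gt0.
- by rewrite !mulr_gt0 ?exprn_gt0 ?divr_gt0.
Qed.

Lemma wiener_increments (k : R) : 0 < k -> exists2 K : R, 0 <= K &
  forall s, 1 <= s -> exists N : set T,
    [/\ measurable N, (P N <= (K / s ^+ 2)%:E)%E &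
     forall w, ~ N w -> forall n j : nat,
       `|W (clock s (j.+1%:R / 2 ^+ n)) w - W (clock s (j%:R / 2 ^+ n)) w|
       <= k * (7 / 8) ^+ n].
Proof.
move=> k0; pose K := 8 * (12 / k ^+ 2) ^+ 6.
have K0 : 0 <= K by rewrite mulr_ge0 ?exprn_ge0 ?divr_ge0 ?sqr_ge0.
exists K => // s s1.
pose B n j := [set w | k * (7 / 8) ^+ n <
  `|W (clock s (j.+1%:R / 2 ^+ n)) w - W (clock s (j%:R / 2 ^+ n)) w|].
have mB n j : measurable (B n j).
  rewrite -[X in measurable X]setTI.
  have mD : measurable_fun setT (fun w =>
      `|W (clock s (j.+1%:R / 2 ^+ n)) w - W (clock s (j%:R / 2 ^+ n)) w|).
    apply: measurableT_comp; first exact: normr_measurable.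
    by apply: measurable_funB; exact: measurable_funPT.
  have -> : B n j = (fun w => `|W (clock s (j.+1%:R / 2 ^+ n)) w -
      W (clock s (j%:R / 2 ^+ n)) w|) @^-1` `]k * (7 / 8) ^+ n, +oo[%classic.
    by apply/seteqP; split => x /=; rewrite in_itv /= andbT.
  exact: mD.
have Ks : 0 <= K / s ^+ 2 by rewrite divr_ge0 ?sqr_ge0.
exists (\bigcup_n \bigcup_j B n j); split.
- by apply: bigcup_measurable => n _; exact: bigcup_measurable.
- apply: (@union_bound _ _ _ _ _ (fun n => 2^-1 ^+ n.+1)) => //.
  + by move=> n; exact: bigcup_measurable.
  + move=> n; apply: (@union_bound _ _ _ _ _
      (fun j => (j.+1%:R)^-1 - (j.+2%:R)^-1)) => //.
    * by rewrite mulr_ge0// exprn_ge0.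
    * by move=> j; exact: wiener_bad_cell.
    * exact: sum_inv_consecutive_le1.
  + exact: sum_halves_le1.
- move=> w Nw n j; rewrite leNgt; apply/negP => h; apply: Nw.
  by exists n => //; exists j.
Qed.

End bad_increments.

(** * The dichotomy in terms of a finite sum of increments *)

Section dichotomy_on_good_paths.
Variable R : realType.
Local Notation mu := (@lebesgue_measure R).

Definition noise_weight (m i : nat) : R := expR (- (i%:R / 2 ^+ m)).

(** The left-point Riemann sum for N in the clock r = (u^2 - s^2)/2: [V] truncates the infinite
    horizon and 2^-m is the mesh. *)
Definition noise_sum (sigma : R) (B : R -> R) (s : R) (V m : nat) : R :=
  \sum_(i < V * 2 ^ m) sigma * noise_weight m i *
    (B (clock s (i.+1%:R / 2 ^+ m)) - B (clock s (i%:R / 2 ^+ m))).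

Lemma clock_continuous (s : R) : continuous (clock s).
Proof.
move=> r; apply: continuous_comp; last exact: sqrt_continuous.
apply: cvgD; first exact: cvg_cst.
by apply: cvgM; [exact: cvg_cst|exact: cvg_id].
Qed.

Lemma clockK (s t : R) : 0 <= s -> s <= t -> clock s ((t ^+ 2 - s ^+ 2) / 2) = t.
Proof.
move=> s0 st; rewrite /clock.
have -> : s ^+ 2 + 2 * ((t ^+ 2 - s ^+ 2) / 2) = t ^+ 2 by field.
by rewrite sqrtr_sqr ger0_norm// (le_trans s0).
Qed.

(** Cutting into at most 1 + (r' - r) unit steps. In the clock, with a = 1/4, this becomes the
    modulus 1/4 + (u^2 - t^2)/8. *)
Lemma modulus_linear_growth (g : R -> R) (a : R) :
  (forall r r', 0 <= r -> r <= r' -> r' <= r + 1 -> `|g r' - g r| <= a) ->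
  forall r r', 0 <= r -> r <= r' -> `|g r' - g r| <= a + a * (r' - r).
Proof.
move=> hg.
have a0 : 0 <= a.
  by have := hg 0 0 (lexx _) (lexx _); rewrite add0r ler01 subrr normr0; apply.
have key (N : nat) r r' : 0 <= r -> r <= r' -> r' <= r + N.+1%:R ->
    `|g r' - g r| <= a * N.+1%:R.
  move=> r0; elim: N r' => [|N IH] r' rr' hr'; first by rewrite mulr1 hg.
  have [h|h] := leP r' (r + N.+1%:R).
    by apply: (le_trans (IH _ rr' h)); rewrite ler_wpM2l// ler_nat.
  have h1 : `|g r' - g (r + N.+1%:R)| <= a.
    by apply: hg; [rewrite addr_ge0|exact: ltW|rewrite -addrA natr1].
  have h2 : `|g (r + N.+1%:R) - g r| <= a * N.+1%:R by apply: IH; rewrite ?lerDl.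
  have := ler_distD (g (r + N.+1%:R)) (g r') (g r).
  rewrite -[X in _ -> _ <= a * X]natr1 mulrDr mulr1; lra.
move=> r r' r0 rr'; have d0 : 0 <= r' - r by rewrite subr_ge0.
apply: (le_trans (key (Num.truncn (r' - r)) r r' r0 rr' _)).
  by rewrite -lerBlDl ltW// truncnS_gt.
by rewrite -natr1 mulrDr mulr1 addrC lerD2l ler_wpM2l// truncn_le.
Qed.

(* The constant 60 = 15 * 4, with 15 from [chaining], gives the modulus 1/4 at
   unit distance that [stationary_exists] asks for. *)
Lemma good_path_dichotomy (sigma s x : R) (V m : nat) (B : R -> R) (f : R -> \bar R) :
  0 < sigma -> 0 < s ->
  {within `[0, +oo[, continuous B} ->
  (forall n j : nat,
    `|B (clock s (j.+1%:R / 2 ^+ n)) - B (clock s (j%:R / 2 ^+ n))|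
      <= (60 * sigma)^-1 * (7 / 8) ^+ n) ->
  {within `[s, +oo[, continuous f} -> f s = x%:E ->
  (forall t, s <= t -> (t%:E < blowup_time s f)%E ->
    f t = (x + (\int[mu]_(u in `[s, t]) (fine (f u) * (fine (f u) - u)))
      + sigma * (B t - B s))%:E) ->
  let err := (7 / 8) ^+ m / 4 + expR (- V%:R) in
  (s^-1 + err < x - s + noise_sum sigma B s V m -> (blowup_time s f < +oo)%E) /\
  (x - s + noise_sum sigma B s V m <= - err -> blowup_time s f = +oo%E).
Proof.
move=> sg0 s0 cB hB cf fs eqf err.
(* Freezing the noise before s makes it continuous on the whole line. *)
pose w t := sigma * (B (Num.max s t) - B s).
have cw : continuous w.
  have cmax : continuous (fun t : R => Num.max s t).
    by move=> u; apply: continuous_max; [exact: cvg_cst|exact: cvg_id].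
  have cBm := within_continuous_comp cB cmax.
  move=> t; apply: cvgM; first exact: cvg_cst.
  apply: cvgB; last exact: cvg_cst.
  by apply: cBm => u; rewrite /= in_itv /= andbT le_max ltW.
have wE t : s <= t -> w t = sigma * (B t - B s) by move=> st; rewrite /w max_r.
have ws : w s = 0 by rewrite wE// subrr mulr0.
pose g r := w (clock s r).
have cg : continuous g.
  move=> q; exact: (@continuous_comp _ _ _ (clock s) w q (@clock_continuous s q) (cw _)).
have hg n r r' : 0 <= r -> r <= r' -> r' <= r + (2 ^+ n)^-1 ->
    `|g r' - g r| <= 4^-1 * (7 / 8) ^+ n.
  move=> r0 rr' hr'.
  have := @chaining R g (60^-1) _ _ n r r' r0 rr' hr'.
  have -> : 15 * 60^-1 = 4^-1 :> R by field.
  apply.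
    by move=> q _; exact: cg.
  move=> k j; rewrite /g.
  have cs i : s <= clock s (i%:R / 2 ^+ k).
    by apply: clock_ge; [exact: ltW|rewrite divr_ge0 ?exprn_ge0].
  rewrite !wE// -mulrBr opprB addrA subrK normrM gtr0_norm//.
  apply: (le_trans (ler_wpM2l (ltW sg0) (hB k j))).
  rewrite mulrA ler_wpM2r ?exprn_ge0 ?divr_ge0//.
  by rewrite invfM mulrCA divff ?mulr1// gt_eqF.
have mod1 t u : s <= t -> t <= u -> `|w u - w t| <= 4^-1 + (u ^+ 2 - t ^+ 2) / 8.
  move=> st tu.
  have su := le_trans st tu.
  have g1 r r' : 0 <= r -> r <= r' -> r' <= r + 1 -> `|g r' - g r| <= 4^-1.
    by move=> r0 rr' hr'; have := hg 0%N r r' r0 rr'; rewrite expr0 invr1 mulr1; apply.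
  have sq (a b : R) : s <= a -> a <= b -> a ^+ 2 <= b ^+ 2.
    move=> sa ab; have a0 := le_trans (ltW s0) sa.
    by rewrite lerXn2r ?nnegrE// (le_trans a0).
  have := modulus_linear_growth g1 (r := (t ^+ 2 - s ^+ 2) / 2) (r' := (u ^+ 2 - s ^+ 2) / 2).
  rewrite /g !clockK ?(ltW s0)//.
  have := sq _ _ (lexx s) st; have := sq _ _ st tu => h1 h2 H.
  have E : 4^-1 + 4^-1 * ((u ^+ 2 - s ^+ 2) / 2 - (t ^+ 2 - s ^+ 2) / 2) =
     4^-1 + (u ^+ 2 - t ^+ 2) / 8 :> R by field.
  by rewrite -E; apply: H; lra.
have cI : continuous (fun r : R => r * expR (- 2^-1 * r ^+ 2) * w r).
  move=> r; apply: cvgM; last exact: cw.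
  apply: cvgM; first exact: cvg_id.
  exact: is_derive_continuous (is_derive_gauss _ r).
have [J [Js dJ _]] := antiderivative s cI.
have [C hC] := stationary_exists (ltW s0) dJ mod1.
have eqf' t : s <= t -> (t%:E < blowup_time s f)%E ->
    f t = (x + (\int[mu]_(u in `[s, t]) (fine (f u) * (fine (f u) - u))) + w t)%:E.
  by move=> st tb; rewrite eqf// wE.
pose u i := clock s (i%:R / 2 ^+ m).
pose n := (V * 2 ^ m)%N.
have p0 : 0 < 2 ^+ m :> R by rewrite exprn_gt0.
have r0 i : 0 <= i%:R / 2 ^+ m :> R by rewrite divr_ge0// ltW.
have u0 : u 0%N = s by rewrite /u mul0r clock0// ltW.
have rS i : i.+1%:R / 2 ^+ m = i%:R / 2 ^+ m + (2 ^+ m)^-1 :> R.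
  by rewrite -natr1 mulrDl mul1r.
have uS i : u i <= u i.+1.
  by apply/ltW/clock_lt => //; rewrite rS ltrDl invr_gt0.
have su i : s <= u i by apply: clock_ge => //; exact: ltW.
have un2 i : u i ^+ 2 = s ^+ 2 + 2 * (i%:R / 2 ^+ m) by rewrite /u clock_sqr.
have nE : n%:R / 2 ^+ m = V%:R :> R.
  by rewrite /n natrM natrX mulfK// gt_eqF.
pose S := \sum_(i < n) expR (- 2^-1 * u i ^+ 2) * (w (u i.+1) - w (u i)).
have [] : `|J (u n) + expR (- 2^-1 * u n ^+ 2) * w (u n) - S|
  <= 4^-1 * (7 / 8) ^+ m * (expR (- 2^-1 * u 0%N ^+ 2) - expR (- 2^-1 * u n ^+ 2)).
  apply: riemann_sum_error => //.
  - by rewrite u0 ltW.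
  - by rewrite u0.
  - by rewrite u0.
  - by rewrite u0.
  - move=> i r _ /andP[uir rui].
    have sr := le_trans (su i) uir.
    have rE : clock s ((r ^+ 2 - s ^+ 2) / 2) = r by rewrite clockK// ltW.
    have rp : 0 <= r := le_trans (ltW s0) sr.
    have uip k : 0 <= u k := le_trans (ltW s0) (su k).
    have q1 : u i ^+ 2 <= r ^+ 2 by rewrite lerXn2r ?nnegrE.
    have q2 : r ^+ 2 <= u i.+1 ^+ 2 by rewrite lerXn2r ?nnegrE.
    rewrite !un2 rS in q1 q2.
    rewrite -[in w r]rE; apply: (hg m).
    + have := r0 i; lra.
    + rewrite rS; lra.
    + rewrite rS; lra.
move=> hS.
have := hC _ (su n).
set E := expR (2^-1 * u n ^+ 2) => hCn.
set e := expR (2^-1 * s ^+ 2).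
have e0 : 0 < e by exact: expR_gt0.
have eVE : expR (- V%:R) * E = e.
  by rewrite /E /e -expRD un2 nE; congr expR; field.
have iE : expR (- 2^-1 * u n ^+ 2) * E = 1 by rewrite /E -expRD mulNr addNr expR0.
have ie : expR (- 2^-1 * u 0%N ^+ 2) * e = 1 by rewrite /e u0 -expRD mulNr addNr expR0.
have eS : e * S = noise_sum sigma B s V m.
  rewrite /S mulr_sumr; apply: eq_bigr => i _.
  rewrite mulrA -expRD /noise_weight !wE// -mulrBr opprB addrA subrK !mulrA.
  congr (_ * _); rewrite [sigma * _]mulrC; congr (expR _ * _).
  have E2 : u i * u i = s * s + 2 * (i%:R / 2 ^+ m) by rewrite -!expr2.
  by rewrite -!mulrA E2; field; rewrite gt_eqF.
have close : `|e * C - noise_sum sigma B s V m| <= err.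
  (* Truncation error: since u_n^2 = s^2 + 2 V, the difference is exactly -exp(-V) D(u_n), and |D|
     <= 1. *)
  have h1 : `|e * C - e * (J (u n) + expR (- 2^-1 * u n ^+ 2) * w (u n))| <= expR (- V%:R).
    have -> : e * C - e * (J (u n) + expR (- 2^-1 * u n ^+ 2) * w (u n)) =
      - (expR (- V%:R) * (w (u n) - E * (C - J (u n)))).
      rewrite -eVE; set a := expR _; set b := expR (- 2^-1 * _) in iE *.
      have -> : a * E * (J (u n) + b * w (u n)) = a * E * J (u n) + a * (b * E) * w (u n) by ring.
      by rewrite iE; ring.
    by rewrite normrN normrM ger0_norm ?expR_ge0// -[leRHS]mulr1 ler_wpM2l ?expR_ge0.
  (* Mesh error: the factor e = exp(s^2/2) normalises the initial weight to 1, and w varies by at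
     most (7/8)^m / 4 on a cell. *)
  have h2 : `|e * (J (u n) + expR (- 2^-1 * u n ^+ 2) * w (u n)) - e * S| <= (7 / 8) ^+ m / 4.
    rewrite -mulrBr normrM gtr0_norm//.
    apply: (le_trans (ler_wpM2l (ltW e0) hS)).
    have -> : e * (4^-1 * (7 / 8) ^+ m * (expR (- 2^-1 * u 0%N ^+ 2) - expR (- 2^-1 * u n ^+ 2))) =
      (7 / 8) ^+ m / 4 * (expR (- 2^-1 * u 0%N ^+ 2) * e - expR (- 2^-1 * u n ^+ 2) * e).
      by move: (expR _) (expR _) (_ ^+ m) => a b c; field.
    rewrite ie -[leRHS]mulr1 ler_wpM2l ?divr_ge0 ?exprn_ge0//.
    by rewrite gerBl mulr_ge0 ?expR_ge0// ltW.
  rewrite -eS.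
  have := ler_distD (e * (J (u n) + expR (- 2^-1 * u n ^+ 2) * w (u n))) (e * C) (e * S).
  rewrite /err; lra.
move: close; rewrite ler_norml => /andP[c1 c2].
split=> hx.
- apply: (@blowup_finite _ s x C f w J) => //.
  by rewrite -/e; lra.
- apply: (@blowup_infinite _ s x C f w J) => //.
  by rewrite -/e; lra.
Qed.

End dichotomy_on_good_paths.

(** * Blow-up probability *)

Section noise_variance.
Variable R : realType.

Definition noise_var (s : R) (V m : nat) : R :=
  \sum_(i < V * 2 ^ m) noise_weight R m i ^+ 2 *
    (clock s (i.+1%:R / 2 ^+ m) - clock s (i%:R / 2 ^+ m)).

Lemma expRN_le_inv (y : R) : 0 < y -> expR (- y) <= y^-1.
Proof.
move=> y0; rewrite expRN lef_pV2 ?posrE ?expR_gt0//.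
by have := expR_ge1Dx y; lra.
Qed.

(** A comparison with the telescoping sum of e_i - e_(i+1) = e_i (1 - q), where 1 - q is close to
    2h. On the horizon V <= s + 1 the clock stays between s and s + 2, so its increments lie between
    h/(s+2) and h/s; and the total 1 - exp(-2V) differs from 1 by at most 1/s. *)
Lemma noise_var_bounds (s : R) (V : nat) : 1 <= s -> s <= V%:R -> V%:R <= s + 1 ->
  1 - 4 * s^-1 <= 2 * s * noise_var s V V <= 1 + 2 * s^-1.
Proof.
move=> s1 sV Vs.
have s0 : 0 < s := lt_le_trans ltr01 s1.
have V0 : 0 < V%:R :> R := lt_le_trans s0 sV.
pose h : R := (2 ^+ V)^-1.
have p0 : 0 < 2 ^+ V :> R by rewrite exprn_gt0.
have h0 : 0 < h by rewrite invr_gt0.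
have hs : h <= s^-1.
  rewrite lef_pV2 ?posrE// (le_trans sV)// -natrX ler_nat ltnW//.
  by rewrite ltn_expl.
pose n := (V * 2 ^ V)%N.
pose q : R := expR (- (2 * h)).
pose e i : R := expR (- (2 * (i%:R * h))).
have eS i : e i.+1 = e i * q.
  by rewrite /e /q -expRD -natr1; congr expR; ring.
have eE i : noise_weight R V i ^+ 2 = e i.
  by rewrite /noise_weight -expRM_natl /e; congr expR; rewrite -/h mulr2n; ring.
have e0 i : 0 <= e i by exact: expR_ge0.
have nh : n%:R * h = V%:R by rewrite /n natrM natrX mulfK// gt_eqF.
have tel : \sum_(i < n) (e i - e i.+1) = 1 - expR (- (2 * V%:R)).
  rewrite -(big_mkord predT (fun i => e i - e i.+1)).
  rewrite (eq_bigr (fun i => - e i.+1 - - e i)); last first.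
    by move=> i _; rewrite opprK addrC.
  rewrite (telescope_sumr (fun i => - e i))//.
  by rewrite opprK addrC /e nh mul0r mulr0 oppr0 expR0.
have q1 : 1 - q <= 2 * h by have := expR_ge1Dx (- (2 * h)); rewrite -/q; lra.
have q2 : 2 * h <= (1 + 2 * h) * (1 - q).
  have : q * (1 + 2 * h) <= 1.
    have qE : q * expR (2 * h) = 1 by rewrite /q -expRD addNr expR0.
    by rewrite -[leRHS]qE ler_wpM2l ?expR_ge0// expR_ge1Dx.
  nra.
pose D (i : nat) := clock s (i.+1%:R * h) - clock s (i%:R * h).
have DE i : (i < n)%N -> [/\ 0 <= D i, s * D i <= h & h <= (s + 2) * D i].
  move=> lin.
  have ri : 0 <= i%:R * h :> R by rewrite mulr_ge0// ltW.
  have rr : i%:R * h < i.+1%:R * h by rewrite ltr_pM2r// ltr_nat.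
  have := clock_diff s0 ri rr; rewrite -/(D i) -mulrBl -natr1 addrAC subrr add0r mul1r natr1.
  have D0 : 0 < D i by rewrite subr_gt0; exact: clock_lt.
  have c1 := clock_ge (ltW s0) ri.
  have ri1 : 0 <= i.+1%:R * h :> R by rewrite mulr_ge0// ltW.
  have c2 := clock_ge (ltW s0) ri1.
  have up r : 0 <= r -> r <= V%:R -> clock s r <= s + 2.
    move=> r0 rV; rewrite -[leRHS]ger0_norm ?addr_ge0 ?(ltW s0)//.
    rewrite -sqrtr_sqr ler_wsqrtr//; nra.
  have iV : i.+1%:R * h <= V%:R by rewrite -nh ler_wpM2r ?(ltW h0)// ler_nat.
  have c3 := up _ ri1 iV.
  have c4 := up _ ri (le_trans (ltW rr) iV).
  by move=> E; split; [exact: ltW|nra|nra].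
have -> : noise_var s V V = \sum_(i < n) e i * D i.
  by apply: eq_bigr => i _; rewrite eE.
have is0 : 0 < s^-1 by rewrite invr_gt0.
have iss : s * s^-1 = 1 by rewrite divff// gt_eqF.
apply/andP; split.
- have eV : expR (- (2 * V%:R)) <= s^-1.
    apply: (@le_trans _ _ (expR (- V%:R))).
      by rewrite ler_expR; lra.
    by apply: (le_trans (expRN_le_inv V0)); rewrite lef_pV2 ?posrE.
  have k0 : 0 < s + 2 by lra.
  apply: (@le_trans _ _ (s / (s + 2) * (1 - expR (- (2 * V%:R))))).
    have e1 : expR (- (2 * V%:R)) <= 1 :> R by rewrite -[leRHS]expR0 ler_expR; lra.
    have sk : s / (s + 2) = 1 - 2 / (s + 2) by field; rewrite gt_eqF.
    have k1 : 2 / (s + 2) <= 2 * s^-1.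
      by rewrite ler_wpM2l// lef_pV2 ?posrE//; lra.
    have k2 : 0 <= 2 / (s + 2) by rewrite divr_ge0// ltW.
    have e2 : 0 <= expR (- (2 * V%:R)) :> R by exact: expR_ge0.
    rewrite sk; nra.
  rewrite -tel !mulr_sumr; apply: ler_sum => i _.
  have [D0 D1 D2] := DE i (ltn_ord i).
  rewrite eS -{1}[e i]mulr1 -mulrBr.
  rewrite [leRHS]mulrCA [leLHS]mulrCA ler_wpM2l//.
  rewrite mulrAC ler_pdivrMr//; nra.
- apply: (@le_trans _ _ ((1 + 2 * h) * (1 - expR (- (2 * V%:R))))).
    rewrite -tel !mulr_sumr; apply: ler_sum => i _.
    have [D0 D1 D2] := DE i (ltn_ord i).
    rewrite eS -{2}[e i]mulr1 -mulrBr.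
    rewrite [leRHS]mulrCA [leLHS]mulrCA ler_wpM2l//.
    nra.
  have e2 : 0 <= expR (- (2 * V%:R)) :> R by exact: expR_ge0.
  nra.
Qed.

(** From 7/8 <= exp(-1/8) and exp(-y) <= 1/y, the two terms are at most 2/V and 1/V. *)
Lemma truncation_error_le (s : R) (V : nat) : 0 < s -> s <= V%:R ->
  (7 / 8) ^+ V / 4 + expR (- V%:R) <= 3 * s^-1.
Proof.
move=> s0 sV; have V0 : 0 < V%:R :> R := lt_le_trans s0 sV.
have Vs : (V%:R)^-1 <= s^-1 by rewrite lef_pV2 ?posrE.
have h1 : expR (- V%:R) <= (V%:R)^-1 := expRN_le_inv V0.
have h2 : (7 / 8) ^+ V <= expR (- (V%:R / 8)) :> R.
  have -> : - (V%:R / 8) = V%:R * (- 8^-1) :> R by ring.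
  rewrite expRM_natl lerXn2r ?nnegrE ?expR_ge0 ?divr_ge0//.
  by have := expR_ge1Dx (- 8^-1 : R); lra.
have h3 : expR (- (V%:R / 8)) <= (V%:R / 8)^-1 :> R by apply: expRN_le_inv; rewrite divr_gt0.
rewrite invf_div in h3.
lra.
Qed.

End noise_variance.

(** * Two-sided bounds on the blow-up probability for fixed s *)

Section blowup_probability_bounds.
Context (R : realType) (d : measure_display) (T : measurableType d)
  (P : probability T R) (W : R -> {RV P >-> R}).
Hypothesis hW : wiener_process W.

Lemma noise_sum_law (sigma s a : R) (V m : nat) : 0 < sigma -> 0 < s -> (0 < V)%N ->
  0 < noise_var s V m ->
  P [set w | (a <= noise_sum sigma (fun t => W t w) s V m)%R] =
  (Phi (- a / (sigma * Num.sqrt (noise_var s V m))))%:E.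
Proof.
move=> sg0 s0 V0 v0.
pose u i := clock s (i%:R / 2 ^+ m).
pose c i := sigma * noise_weight R m i.
have p0 : 0 < 2 ^+ m :> R by rewrite exprn_gt0.
have r0 i : 0 <= i%:R / 2 ^+ m :> R by rewrite divr_ge0// ltW.
have u0 : 0 <= u 0%N by rewrite /u sqrtr_ge0.
have uS i : u i < u i.+1.
  by apply: clock_lt => //; rewrite ltr_pM2r ?invr_gt0// ltr_nat.
have c0 i : 0 < c i by rewrite mulr_gt0 ?expR_gt0.
have : (0 < V * 2 ^ m)%N by rewrite muln_gt0 V0 expn_gt0.
case nE : (V * 2 ^ m)%N => [//|n] _.
have mB : measurable (`[a, +oo[%classic : set R) by [].
have := wiener_weighted_sum n hW u0 uS c0 mB.
have -> : \sum_(i < n.+1) c i ^+ 2 * (u i.+1 - u i) = sigma ^+ 2 * noise_var s V m.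
  rewrite /noise_var nE mulr_sumr; apply: eq_bigr => i _.
  by rewrite /c exprMn mulrA.
rewrite sqrtrM ?sqr_ge0// sqrtr_sqr gtr0_norm//.
rewrite normal_prob_cy ?mulr_gt0 ?sqrtr_gt0// => <-.
congr (P _); apply/seteqP; split=> w; rewrite /= in_itv /= andbT /noise_sum nE.
  by [].
by [].
Qed.

Lemma probability_sandwich (A L U N : set T) (e : R) :
  measurable A -> measurable L -> measurable U -> measurable N ->
  (P N <= e%:E)%E -> L `<=` A `|` N -> A `<=` U `|` N ->
  (P L - e%:E <= P A)%E /\ (P A <= P U + e%:E)%E.
Proof.
move=> mA mL mU mN PN LA AU; split.
- rewrite leeBlDr//; apply: (le_trans (y := P (A `|` N))).
    by apply: le_measure; rewrite ?inE//; exact: measurableU.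
  by apply: (le_trans (measureU2 P mA mN)); rewrite leeD2l.
- apply: (le_trans (y := P (U `|` N))).
    by apply: le_measure; rewrite ?inE//; exact: measurableU.
  by apply: (le_trans (measureU2 P mU mN)); rewrite leeD2l.
Qed.

Lemma noise_sum_measurable (sigma s a : R) (V m : nat) :
  measurable [set w | (a <= noise_sum sigma (fun t => W t w) s V m)%R].
Proof.
have mS : measurable_fun setT (fun w => noise_sum sigma (fun t => W t w) s V m).
  apply: measurable_sum => i; apply: measurable_funM; first exact: measurable_cst.
  by apply: measurable_funB; exact: measurable_funPT.
rewrite -[X in measurable X]setTI.
have -> : [set w | a <= noise_sum sigma (fun t => W t w) s V m] =
    (fun w => noise_sum sigma (fun t => W t w) s V m) @^-1` `[a, +oo[%classic.
  by apply/seteqP; split=> w; rewrite /= in_itv /= andbT.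
exact: mS.
Qed.

Lemma blowup_probability_bounds (sigma : R) : 0 < sigma ->
  exists2 K : R, 0 <= K &
  forall (s x : R) (V : nat) (X : R -> T -> \bar R), 1 <= s -> s <= V%:R ->
    0 < noise_var s V V -> local_solution W sigma s x X ->
    let sd := sigma * Num.sqrt (noise_var s V V) in
    ((Phi ((x - s - 5 * s^-1) / sd))%:E - (K / s ^+ 2)%:E <= blowup_probability P s X)%E /\
    (blowup_probability P s X <= (Phi ((x - s + 5 * s^-1) / sd))%:E + (K / s ^+ 2)%:E)%E.
Proof.
move=> sg0.
have k0 : 0 < (60 * sigma)^-1 by rewrite invr_gt0 mulr_gt0.
have [K K0 hK] := wiener_increments hW k0.
exists K => // s x V X s1 sV v0 hX sd.
have s0 : 0 < s := lt_le_trans ltr01 s1.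
have V0 : (0 < V)%N by rewrite -(ltr_nat R); exact: lt_le_trans sV.
have [N [mN PN hN]] := hK s s1.
have [N0 [mN0 PN0 hN0]] := filterI (wiener_continuous hW)
  (filterI (solution_start hX)
    (filterI (solution_continuous hX) (solution_equation hX))).
set A := [set w | (blowup_time s (fun t => X t w) < +oo)%E].
have mA : measurable A.
  rewrite -[A]setTI; apply: emeasurable_fun_infty_o => //.
  exact: blowup_time_measurable hX.
pose S w := noise_sum sigma (fun t => W t w) s V V.
(* The threshold 1/s of the explosion criterion and the error 3/s add up to 4/s; with 5/s the strict
   inequality required there follows from a weak one. *)
have good w : ~ (N `|` N0) w ->
    (5 * s^-1 - (x - s) <= S w -> A w) /\
    (A w -> - (5 * s^-1) - (x - s) <= S w).
  move=> /not_orP[nN nN0].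
  have [cW [Xs [cX eX]]] : [set w | {within `[0, +oo[, continuous (fun t : R => W t w)}] w /\
    X s w = x%:E /\ {within `[s, +oo[, continuous (fun t : R => X t w)} /\
    (forall t : R, s <= t -> (t%:E < blowup_time s (fun u => X u w))%E ->
     X t w = (x + (\int[lebesgue_measure]_(u in `[s, t])
            (fine (X u w) * (fine (X u w) - u))) + sigma * (W t w - W s w))%:E).
    by apply: contrapT => h; apply: nN0; apply: hN0.
  have [up low] := good_path_dichotomy V V sg0 s0 cW (hN w nN) cX Xs eX.
  have err := truncation_error_le s0 sV.
  have is0 : 0 < s^-1 by rewrite invr_gt0.
  split => [hS|Aw].
  - by apply: up; rewrite /S in hS; lra.
  - rewrite leNgt; apply/negP => hS.
    move: Aw; rewrite /A /= low ?ltxx//.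
    by rewrite /S in hS; lra.
have mNN : measurable (N `|` N0) by exact: measurableU.
have PNN : (P (N `|` N0) <= (K / s ^+ 2)%:E)%E.
  apply: (le_trans (measureU2 P mN mN0)).
  by rewrite [X in (_ + X)%E](_ : _ = 0%E) ?adde0.
pose lo := 5 * s^-1 - (x - s).
pose hi := - (5 * s^-1) - (x - s).
have [||] := @probability_sandwich A [set w | lo <= S w] [set w | hi <= S w]
  (N `|` N0) (K / s ^+ 2) mA (noise_sum_measurable _ _ _ _ _)
  (noise_sum_measurable _ _ _ _ _) mNN PNN.
- move=> w /= Sw; have [nw|nw] := pselect ((N `|` N0) w); first by right.
  by left; apply: (good w nw).1.
- move=> w Aw; have [nw|nw] := pselect ((N `|` N0) w); first by right.
  by left; apply: (good w nw).2.
rewrite !noise_sum_law// -/sd.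
have -> : - lo = x - s - 5 * s^-1 by rewrite /lo; ring.
have -> : - hi = x - s + 5 * s^-1 by rewrite /hi; ring.
by [].
Qed.

End blowup_probability_bounds.

(** * Passage to the limit as s tends to infinity *)

Section limits.
Variable R : realType.

Lemma inv_cvg0 : s^-1 @[s --> +oo%R] --> (0 : R).
Proof.
apply/gtr0_cvgV0; last exact: cvg_id.
by near=> s; near: s; exact: nbhs_pinfty_gt.
Unshelve. all: by end_near. Qed.

Lemma affine_inv_cvg (a b : R) : a + b * s^-1 @[s --> +oo%R] --> a.
Proof.
rewrite -[X in _ --> X]addr0 -[X in _ + X](mulr0 b).
apply: cvgD; first exact: cvg_cst.
by apply: cvgM; [exact: cvg_cst|exact: inv_cvg0].
Qed.

(** The standard deviation of the noise in units of sigma/sqrt(2s). The integer V, in ]s, s + 1], is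
    both horizon and mesh exponent, so that both errors are O(1/s). *)
Definition normalized_sd (s : R) : R :=
  let V := (Num.truncn s).+1 in Num.sqrt (2 * s * noise_var s V V).

Lemma normalized_sd_cvg1 : normalized_sd s @[s --> +oo%R] --> (1 : R).
Proof.
rewrite -[X in _ --> X]sqrtr1.
apply: continuous_cvg; first exact: sqrt_continuous.
apply: (squeeze_cvgr (f := fun s => 1 - 4 * s^-1) (h := fun s => 1 + 2 * s^-1)).
- near=> s.
  have s1 : 1 <= s by near: s; exact: nbhs_pinfty_ge.
  have sV : s <= (Num.truncn s).+1%:R by apply: ltW; exact: truncnS_gt.
  have Vs : (Num.truncn s).+1%:R <= s + 1.
    by rewrite -natr1 lerD2r truncn_le// (le_trans ler01).
  exact: noise_var_bounds.
- under eq_fun do rewrite -mulNr.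
  exact: affine_inv_cvg.
- exact: affine_inv_cvg.
Unshelve. all: by end_near. Qed.

Lemma standardized_cvg (z b : R) :
  (z + b * Num.sqrt (2 * s^-1)) / normalized_sd s @[s --> +oo%R] --> z.
Proof.
rewrite -[X in _ --> X]addr0 -[X in _ + X](mulr0 b) -[X in _ --> X]divr1.
apply: cvgM; last by apply: cvgV; [exact: oner_neq0|exact: normalized_sd_cvg1].
apply: cvgD; first exact: cvg_cst.
apply: cvgM; first exact: cvg_cst.
rewrite -[X in _ --> X]sqrtr0; apply: continuous_cvg; first exact: sqrt_continuous.
rewrite -[X in _ --> X](mulr0 2).
by apply: cvgM; [exact: cvg_cst|exact: inv_cvg0].
Qed.

(** Here the margin b/s, divided by sigma/sqrt(2s), becomes (b/sigma) sqrt(2/s), which vanishes in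
    the limit. *)
Lemma standardizedE (sigma s z b v : R) : 0 < sigma -> 0 < s -> 0 < v ->
  (z * (sigma / Num.sqrt (2 * s)) + b * s^-1) / (sigma * Num.sqrt v) =
  (z + b / sigma * Num.sqrt (2 * s^-1)) / Num.sqrt (2 * s * v).
Proof.
move=> sg0 s0 v0.
have s20 : 0 < 2 * s by rewrite mulr_gt0.
have -> : 2 * s^-1 = 2 * s / s ^+ 2 by field; rewrite gt_eqF.
rewrite [Num.sqrt (2 * s / s ^+ 2)]sqrtrM ?(ltW s20)// [Num.sqrt (2 * s * v)]sqrtrM ?(ltW s20)//.
rewrite sqrtrV ?sqr_ge0// sqrtr_sqr gtr0_norm//.
have r0 : 0 < Num.sqrt (2 * s) by rewrite sqrtr_gt0.
have q0 : 0 < Num.sqrt v by rewrite sqrtr_gt0.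
have : Num.sqrt (2 * s) ^+ 2 = 2 * s by rewrite sqr_sqrtr// ltW.
move: (Num.sqrt (2 * s)) (Num.sqrt v) r0 q0 => r q r0 q0 rE.
by field; rewrite !gt_eqF.
Qed.

Lemma Phi_perturbed_cvg (z b K : R) :
  ((Phi ((z + b * Num.sqrt (2 * s^-1)) / normalized_sd s))%:E +
    (K / s ^+ 2)%:E)%E @[s --> +oo%R] --> (Phi z)%:E.
Proof.
under eq_fun do rewrite -EFinD.
apply: cvg_EFin; first exact: nearW.
rewrite -[X in _ --> X]addr0 -[X in _ + X](mulr0 K) -[in X in _ + X](mulr0 0).
apply: cvgD.
  apply: continuous_cvg; first exact: Phi_continuous.
  exact: standardized_cvg.
apply: cvgM; first exact: cvg_cst.
under eq_fun do rewrite -exprVn expr2.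
by apply: cvgM; exact: inv_cvg0.
Qed.

End limits.
Unset Implicit Arguments.

Theorem theorem4p7 (R : realType) (d : measure_display)
    (T : measurableType d) (P : probability T R) (W : R -> {RV P >-> R})
    (sigma : R) (X : R -> R -> R -> T -> \bar R)
    (hW : wiener_process W) (hsigma : 0 < sigma)
    (hX : forall s x : R, 0 <= s -> local_solution W sigma s x (X s x))
    (z : R) :
  blowup_probability P s (X s (s + z * (sigma / Num.sqrt (2 * s))))
    @[s --> +oo%R] --> (Phi z)%:E.
Proof.
have [K K0 hK] := blowup_probability_bounds hW hsigma.
have lo := @Phi_perturbed_cvg R z (- 5 / sigma) (- K).
have hi := @Phi_perturbed_cvg R z (5 / sigma) K.
apply: squeeze_cvge lo hi.
near=> s.
(* For s >= 5 the lower bound 1 - 4/s on the normalised variance is at least 1/5, hence positive. *)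
have s5 : 5 <= s by near: s; exact: nbhs_pinfty_ge.
have s1 : 1 <= s by lra.
have s0 : 0 < s by lra.
pose V := (Num.truncn s).+1.
have sV : s <= V%:R by rewrite ltW// truncnS_gt.
have Vs : V%:R <= s + 1 by rewrite -natr1 lerD2r truncn_le// ltW.
have v0 : 0 < noise_var s V V.
  have /andP[+ _] := noise_var_bounds s1 sV Vs.
  have : s^-1 <= 5^-1 by rewrite lef_pV2 ?posrE.
  nra.
have [lower upper] := hK s _ V _ s1 sV v0 (hX s (s + z * (sigma / Num.sqrt (2 * s))) (ltW s0)).
have xs : s + z * (sigma / Num.sqrt (2 * s)) - s = z * (sigma / Num.sqrt (2 * s)).
  by rewrite addrAC subrr add0r.
rewrite xs -[- (5 * s^-1)]mulNr standardizedE// -EFinN -[- (K / _)]mulNr in lower.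
rewrite xs standardizedE// in upper.
by rewrite lower upper.
Unshelve. all: by end_near. Qed.
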